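(* Let $k,n$ be positive integers. Then \[ 2n^2\left(\frac{1}{k^2+2000k^{7/4}}\right) - n < \nu_k(K_{k+1,n}) \le \frac{2n^2}{k^2}+\frac{n}{2}. \] Consequently, \[ \lim_{k\to\infty}\left(\lim_{n\to\infty}\frac{\nu_k(K_{k+1,n})}{2n^2/k^2}\right)=1. \]
   Context: A book with $k$ pages consists of a line (the spine) and $k$ half-planes (the pages) whose common boundary is the spine. A $k$-page drawing of a graph places all vertices on the spine and draws each edge inside a single page (edges may cross). The $k$-page crossing number $\nu_k(G)$ is the minimum number of crossings over all $k$-page drawings of $G$. *)

(* Defs.v *)
From HB Require Import structures.
From mathcomp Require Import all_boot all_order all_fingroup all_algebra.
From mathcomp Require Import all_classical all_reals all_analysis.
Set Implicit Arguments. Unset Strict Implicit. Unset Printing Implicit Defensive.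
Import Order.TTheory GRing.Theory Num.Theory.

(* A k-page book drawing: a linear order of the vertices on the spine
   (position of v is enum_rank (s v) for a permutation s of V) and an
   assignment of a page in {0..k-1} to every edge. *)
Definition book_drawing (V E : finType) (k : nat) : finType :=
  ({perm V} * {ffun E -> 'I_k})%type.

Section Book.
Variables (V E : finType) (ends : E -> V * V) (k : nat).

Definition spine_pos (s : {perm V}) (v : V) : nat := enum_rank (s v).

Definition lo_end (s : {perm V}) (e : E) : nat :=
  minn (spine_pos s (ends e).1) (spine_pos s (ends e).2).
Definition hi_end (s : {perm V}) (e : E) : nat :=
  maxn (spine_pos s (ends e).1) (spine_pos s (ends e).2).

(* Edges e and f cross (counted once, for the ordered pair with e's left
   endpoint first) iff they lie on the same page and their endpoints
   strictly interleave along the spine. *)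
Definition book_cross (d : book_drawing V E k) (e f : E) : bool :=
  (d.2 e == d.2 f) &&
  [&& lo_end d.1 e < lo_end d.1 f, lo_end d.1 f < hi_end d.1 e
    & hi_end d.1 e < hi_end d.1 f].

Definition book_crossings (d : book_drawing V E k) : nat :=
  #|[set ef : E * E | book_cross d ef.1 ef.2]|.

(* k-page crossing number: minimum over all k-page drawings.  The seed
   #|E|^2 is an upper bound on book_crossings of any drawing, so it does
   not affect the minimum whenever a drawing exists (k >= 1). *)
Definition book_cr : nat :=
  \big[minn/(#|E| ^ 2)%N]_(d : book_drawing V E k) book_crossings d.
End Book.

Definition Kmn_ends (m n : nat) (e : 'I_m * 'I_n) : ('I_m + 'I_n) * ('I_m + 'I_n) :=
  (inl e.1, inr e.2).

Definition nu_K (k m n : nat) : nat := book_cr (@Kmn_ends m n) k.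

(* Main.v *)
(** Call the [k+1] vertices of the first part black and the [n] others white.

    Lower bound.  The key fact is that a crossing-free [k]-page drawing of
    [K_{k+1,N}] has [4 N <= k^2 + 2000 k^(7/4)]; it bounds the independent sets
    of the graph on the white vertices whose edges join stars that cross, and
    Turan's theorem then gives [n^2 / (2 N) - n / 2] crossings.
    For the key fact, a white vertex has [k+1] edges and only [k] pages, so some
    page repeats at it; by planarity of each page there are few white vertices
    missing more than [k^(1/4)] pages, and these are discarded.  Cut the spine
    into alternating runs of black vertices (groups) and white vertices (gaps).
    When one moves along white vertices, the black neighbour in a fixed page can
    only turn one way, so few pages can be repeated across a given cut of the
    black vertices while the white vertex runs through a given interval
    ([flux]).  Contracting gaps and groups shows that on average a page sees only
    one group from a gap; so pages repeated on two groups, or inside a group with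
    at most [k^(1/2)] vertices, are rare.  Finally, if [t] black vertices lie in
    larger groups, the number of repetitions inside them is at most about
    [t (k + 1 - t) <= (k + 1)^2 / 4].

    Upper bound.  With [A + p = k + 1] and [A], [p] almost equal, [K_{k+1,A p}]
    has a drawing without crossings; in a drawing of [K_{k+1,n}] obtained by
    cloning its white vertices, two clones of the same vertex cross once.

    The inner limit exists because [nu n / (n (n - 1))] is nondecreasing. *)

Require Import Defs.
From HB Require Import structures.
From mathcomp Require Import all_boot all_order all_fingroup all_algebra.
From mathcomp Require Import zify ring lra.
Set Implicit Arguments. Unset Strict Implicit. Unset Printing Implicit Defensive.
Import Order.TTheory GRing.Theory Num.Theory.

(** * Noncrossing bipartite graphs *)

Section Chords.
Variables (n : nat) (side : nat -> bool) (S : rel nat).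
Hypothesis S_side : forall i j, S i j -> side i != side j.
Hypothesis S_nc : forall i j i' j',
  S i j -> S i' j' -> ~~ [&& i < i', i' < j & j < j'].

Definition chords (p q : nat) : {set 'I_n * 'I_n} :=
  [set e : 'I_n * 'I_n | [&& p <= e.1, e.1 < e.2, e.2 <= q & S e.1 e.2]].

(** Induction on the length, splitting the interval at the furthest neighbour [j] of [p] before [q].
    The parity term makes it close: if [p] and [q] are on different sides, then [j] and [q] are on
    the same side, and the extra unit gained there pays for the chord from [p] to [q]. *)
Lemma card_chords l p q : q - p <= l -> p < q ->
  2 * #|chords p q| + (if side p == side q then 2 else 1) <= 3 * (q - p).
Proof.
elim: l p q => [|l IH] p q; first by lia.
move=> lq pq.
have le1 (e : bool) (X Y Z : {set 'I_n * 'I_n}) : X \subset Y :|: Z -> #|Z| <= e -> #|X| <= #|Y| + e.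
  move=> sXYZ Ze; apply: leq_trans (subset_leq_card sXYZ) _.
  by apply: leq_trans (leq_card_setU Y Z).1 _; rewrite leq_add2l.
pose top := [set e : 'I_n * 'I_n | [&& (e.1 == p :> nat), (e.2 == q :> nat) & S p q]].
have card_top : #|top| <= S p q.
  case Spq: (S p q); last first.
    by rewrite leqn0 cards_eq0; apply/eqP/setP=> e; rewrite !inE Spq !andbF.
  apply/card_le1_eqP => -[i j] [i' j']; rewrite !inE Spq /= !andbT.
  by move=> /andP[/eqP ei /eqP ej] /andP[/eqP ei' /eqP ej']; congr pair; apply: val_inj; rewrite /= ?ei ?ej ?ei' ?ej'.
case: (pickP (fun j : 'I_q => (p < j) && S p j)) => [j0 Pj0|noj].
- have [j /andP[pj Spj] jmax] :=
    @arg_maxnP _ j0 (fun j : 'I_q => (p < j) && S p j) (fun j => j : nat) Pj0.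
  have jq := ltn_ord j.
  have c1 := IH p j ltac:(lia) pj; have c2 := IH j q ltac:(lia) jq.
  have sj := S_side Spj.
  have : #|chords p q| <= #|chords p j :|: chords j q| + S p q.
    apply: le1 card_top; apply/subsetP=> -[a b]; rewrite !inE /=.
    case/and4P=> pa ab bq Sab; rewrite pa ab bq Sab /= !andbT.
    have := S_nc Spj Sab; have : a = p :> nat -> b <= j \/ (b = q :> nat).
      move=> ap; case: (ltnP b q) => bq'; last by right; lia.
      by left; rewrite ap in Sab; have := jmax (Ordinal bq'); rewrite /= Sab andbT => -> //; lia.
    case: (eqVneq (a : nat) p) => [ap|nap].
      by case=> // [|bq']; [lia|rewrite ap bq' in Sab *; rewrite eqxx Sab !orbT].
    by lia.
  have := (leq_card_setU (chords p j) (chords j q)).1.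
  have: S p q -> side p != side q by exact: S_side.
  case: (S p q) => [/(_ isT)|_]; move: sj c1 c2;
    case: (side p); case: (side q); case: (side j) => //=; lia.
(* Here [p] has no neighbour before [q], so dropping [p] loses at most the chord from [p] to [q]. *)
- have [q1|q1] := ltnP p.+1 q.
    have c1 := IH p.+1 q ltac:(lia) q1.
    have : #|chords p q| <= #|chords p.+1 q| + S p q.
      apply: le1 card_top; apply/subsetP=> -[a b]; rewrite !inE /=.
      case/and4P=> pa ab bq Sab; rewrite ab bq Sab /= !andbT.
      case: (eqVneq (a : nat) p) => [ap|]; last by lia.
      case: (ltnP b q) => bq'; last first.
        have bq2 : b = q :> nat by lia.
        by rewrite -bq2 -ap Sab eqxx orbT.
      by have := noj (Ordinal bq'); rewrite /= -ap ab Sab.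
    have: S p q -> side p != side q by exact: S_side.
    case: (S p q) => [/(_ isT)|_]; move: c1;
      case: (side p); case: (side q); case: (side p.+1) => //=; lia.
  have qE : q = p.+1 by lia.
  have : #|chords p q| <= S p q.
    apply: leq_trans card_top; apply: subset_leq_card; apply/subsetP=> -[a b].
    rewrite !inE /= => /and4P[pa ab bq Sab].
    have ap : a = p :> nat by lia.
    have bq' : b = q :> nat by lia.
  by rewrite ap bq' !eqxx /= -ap -bq'.
  have: S p q -> side p != side q by exact: S_side.
  case: (S p q) => [/(_ isT)|_]; rewrite qE;
    case: (side p); case: (side p.+1) => //=; lia.
Qed.

End Chords.

(* The chord [x', y'] leaves the chord [x, y] to the right; unlike crossing, this
   is not symmetric in the two chords. *)
Definition cross4 (x y x' y' : nat) : bool :=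
  [&& minn x y < minn x' y', minn x' y' < maxn x y & maxn x y < maxn x' y'].

(** * Positions compressed to ranks *)

Section Rank.
Variables (V : finType) (pos : V -> nat).
Hypothesis pos_inj : injective pos.

Definition rank (v : V) : nat := #|[set u | pos u < pos v]|.

Lemma ltn_rank u v : (rank u < rank v) = (pos u < pos v).
Proof.
have mono a b : pos a < pos b -> rank a < rank b.
  move=> ab; apply: proper_card; apply/properP; split.
    by apply/subsetP=> c; rewrite !inE => /ltn_trans; apply.
  by exists a; rewrite !inE ?ltnn.
apply/idP/idP; last exact: mono.
apply: contraTT; rewrite -!leqNgt leq_eqVlt => /orP[/eqP/pos_inj->//|/mono/ltnW//].
Qed.

Lemma rank_inj : injective rank.
Proof.
move=> u v uv; apply: pos_inj.
have := ltn_rank u v; have := ltn_rank v u; rewrite uv ltnn => /esym/negbT + /esym/negbT.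
by rewrite -!leqNgt => le ge; apply/eqP; rewrite eqn_leq le ge.
Qed.

Lemma rank_bound v : rank v < #|V|.
Proof.
rewrite -cardsT; apply: proper_card; apply/properP; split; first exact: subsetT.
by exists v; rewrite !inE ?ltnn.
Qed.

Lemma cross4_rank x y x' y' :
  cross4 (rank x) (rank y) (rank x') (rank y') = cross4 (pos x) (pos y) (pos x') (pos y').
Proof. by rewrite /cross4 !(gtn_min, gtn_max, leq_min, leq_max) !ltn_rank. Qed.

End Rank.

Section Planar.
Variables (X Y : finType) (pX : X -> nat) (pY : Y -> nat).
Hypotheses (pX_inj : injective pX) (pY_inj : injective pY).
Hypothesis pXY : forall x y, pX x != pY y.
Variable E : {set X * Y}.
Hypothesis E_nc : forall e f, e \in E -> f \in E ->
  ~~ cross4 (pX e.1) (pY e.2) (pX f.1) (pY f.2).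

Let pos (v : X + Y) : nat := match v with inl x => pX x | inr y => pY y end.
Let pos_inj : injective pos.
Proof.
move=> [x|y] [x'|y'] /= => [/pX_inj-> | /eqP | /esym/eqP | /pY_inj->] //;
by rewrite (negPf (pXY _ _)).
Qed.
Let rk := rank pos.

(** After compressing positions to ranks, the edges of one page are noncrossing chords between the
    two sides, and [card_chords] applies to the whole interval. *)
Lemma planar_bipartite : 2 * #|E| <= 3 * (#|X| + #|Y|).
Proof.
case: (posnP #|E|) => [->//|]; rewrite card_gt0 => /set0Pn[[x0 y0] E0].
pose n := #|{: X + Y}|; have nE : n = #|X| + #|Y| by rewrite /n card_sum.
pose ro v : 'I_n := Ordinal (rank_bound pos v).
pose side i := [exists x, rk (inl x) == i].
have sideX x : side (rk (inl x)) by apply/existsP; exists x.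
have sideY y : side (rk (inr y)) = false.
  by apply/existsP=> -[x /eqP/(rank_inj pos_inj)].
pose S i j := [exists e in E, [&& minn (rk (inl e.1)) (rk (inr e.2)) == i
                               & maxn (rk (inl e.1)) (rk (inr e.2)) == j]].
have S_side i j : S i j -> side i != side j.
  case/existsP=> e /and3P[_ /eqP<- /eqP<-].
  by case: (ltnP (rk (inl e.1)) (rk (inr e.2))) => _; rewrite sideX sideY.
have S_nc i j i' j' : S i j -> S i' j' -> ~~ [&& i < i', i' < j & j < j'].
  case/existsP=> -[x y] /and3P[eE /eqP<- /eqP<-].
  case/existsP=> -[x' y'] /and3P[fE /eqP<- /eqP<-] /=.
  have := E_nc eE fE; apply: contra => /=.
  by rewrite -[in X in _ -> X](cross4_rank pos_inj (inl x) (inr y) (inl x') (inr y')).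
have n1 : 0 < n.-1.
  have : 0 < #|X| /\ 0 < #|Y| by split; apply/card_gt0P; [exists x0|exists y0].
  by lia.
have := @card_chords n side S S_side S_nc n.-1 0 n.-1 (leq_subr _ _) n1.
suff : #|E| <= #|chords n S 0 n.-1| by rewrite -nE; lia.
pose phi (e : X * Y) : 'I_n * 'I_n :=
  if rk (inl e.1) < rk (inr e.2) then (ro (inl e.1), ro (inr e.2))
  else (ro (inr e.2), ro (inl e.1)).
have phi_inj : {in E &, injective phi}.
  move=> [x y] [x' y'] _ _; rewrite /phi /=.
  case: ifP => _; case: ifP => _ [] /(rank_inj pos_inj) + /(rank_inj pos_inj) => // -[->] [->] //.
rewrite -(card_in_imset phi_inj); apply: subset_leq_card.
apply/subsetP=> _ /imsetP[[x y] eE ->]; rewrite inE /phi /rk /=.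
have ne : rank pos (inl x) != rank pos (inr y) by apply/eqP=> /(rank_inj pos_inj).
have := rank_bound pos (inl x); have := rank_bound pos (inr y); rewrite -/n => b1 b2.
case: ifP => lt /=; apply/and3P; split=> //; try lia;
  by apply/existsP; exists (x, y); rewrite eE /= /rk; lia.
Qed.
End Planar.

(** * Gaps, groups and the flux of colours *)

(** Only the set [V] of white vertices of degree at least 2 counts. For the number [e] of their
    edges, [2 |V| <= e], and planarity gives [2 e <= 3 (|B| + |V|)]; eliminating [|V|] leaves
    [e <= 6 |B|]. *)
Lemma planar_page_excess (B W : finType) (E : B -> W -> bool) (pB : B -> nat) (pW : W -> nat) :
  injective pB -> injective pW -> (forall b w, pB b != pW w) ->
  (forall a w b w', E a w -> E b w' -> ~~ cross4 (pB a) (pW w) (pB b) (pW w')) ->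
  \sum_(w : W) (#|[set b | E b w]| - 1) <= 6 * #|B|.
Proof.
move=> pB_inj pW_inj pBW E_nc; pose deg w := #|[set b | E b w]|.
pose A := [set w | 1 < deg w]; pose V := {w in A}.
pose ES : {set B * V} := [set e : B * V | E e.1 (val e.2)].
have := @planar_bipartite B V pB (fun w => pW (val w)) pB_inj
  (inj_comp pW_inj val_inj) (fun b w => pBW b (val w)) ES.
have -> : #|ES| = \sum_(w : V) deg (val w).
  rewrite (eq_bigr (fun w : V => \sum_(b : B) E b (val w))); last first.
    move=> w _; rewrite /deg -sum1_card big_mkcond /=.
    by apply: eq_bigr => b _; rewrite inE; case: (E _ _).
  rewrite exchange_big pair_big /= -sum1_card big_mkcond /=.
  by apply: eq_bigr => e _; rewrite inE; case: (E _ _).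
move=> H.
have {}H : 2 * \sum_(w : V) deg (val w) <= 3 * (#|B| + #|{: V}|).
  by apply: H => -[a w] [b w']; rewrite !inE; apply: E_nc.
have cV : 2 * #|{: V}| <= \sum_(w : V) deg (val w).
  rewrite -sum1_card big_distrr /=; apply: leq_sum => w _; rewrite muln1.
  by have := valP w; rewrite inE.
apply: (@leq_trans (\sum_(w : V) deg (val w))); last by lia.
rewrite (bigID (mem A)) /= [X in _ + X]big1 ?addn0; last first.
  by move=> w; rewrite inE -leqNgt /deg => dw; apply/eqP; rewrite subn_eq0.
rewrite -(big_sub A deg); apply: leq_sum => w _; exact: leq_subr.
Qed.

(** * Pages at the white vertices and the flux argument *)

Section Star.
Variables (B W : finType) (k : nat) (col : B -> W -> 'I_k).
Variables (pB : B -> nat) (pW : W -> nat).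

Definition colours (w : W) (Q : {set B}) : {set 'I_k} := [set col b w | b in Q].

Definition noncrossing_star : Prop :=
  [/\ injective pB, injective pW, forall b w, pB b != pW w &
      forall a w b w', w != w' -> col a w = col b w' ->
        ~~ cross4 (pB a) (pW w) (pB b) (pW w')].

(* A page repeated across the cut by an inner white vertex occurs neither on the [Q]
   side at the first vertex [f] nor on the [P] side at the last vertex [l], and
   distinct vertices repeat distinct pages. *)
Lemma flux (Z : {set W}) (Q P : {set B}) (Col : {set 'I_k}) (f l : W) :
  injective pW -> f \in Z -> l \in Z ->
  (forall w, w \in Z -> pW f <= pW w <= pW l) ->
  (forall w w' a b, w \in Z -> w' \in Z -> pW w < pW w' -> a \in Q -> b \in P ->
     col a w != col b w') ->
  (forall w b, w \in Z -> b \in Q :|: P -> col b w \in Col) ->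
  #|[set w in Z | [&& w != f, w != l
       & [exists a in Q, exists b in P, col a w == col b w]]]|
    <= #|Col| - #|colours f Q| - #|colours l P|.
Proof.
move=> pW_inj fZ lZ flP nc ColP.
set D := [set w in Z | _].
have ltf w : w \in Z -> w != f -> pW f < pW w.
  by move=> wZ wf; have := flP _ wZ; rewrite leq_eqVlt => /andP[/orP[/eqP/pW_inj e|//]]; rewrite e eqxx in wf.
have ltl w : w \in Z -> w != l -> pW w < pW l.
  by move=> wZ wf; have := flP _ wZ; rewrite [pW w <= _]leq_eqVlt => /andP[_ /orP[/eqP/pW_inj e|//]]; rewrite e eqxx in wf.
have [fl|fl] := eqVneq f l.
  rewrite (_ : D = set0) ?cards0 //; apply/setP=> w; rewrite !inE.
  apply/negP=> /and4P[wZ wf wl _]; have := ltf _ wZ wf; have := ltl _ wZ wl.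
  by rewrite fl; lia.
have flt : pW f < pW l by apply: ltf; rewrite // eq_sym.
have disj : [disjoint colours f Q & colours l P].
  apply/pred0P=> c /=; apply/negP=> /andP[/imsetP[a aQ ->] /imsetP[b bP /eqP]].
  by apply/negP; apply: nc.
have sub : colours f Q :|: colours l P \subset Col.
  apply/subsetP=> c /setUP[] /imsetP[b bQ ->]; apply: ColP => //; rewrite inE bQ ?orbT //.
rewrite -subnDA.
have -> : #|colours f Q| + #|colours l P| = #|colours f Q :|: colours l P|.
  by apply/esym/eqP; rewrite (leq_card_setU _ _).2.
rewrite -cardsDS //.
case: (set_0Vmem D) => [->|[w0 w0D]]; first by rewrite cards0.
have exc w : w \in D -> exists c : 'I_k, (c \in colours w Q) && (c \in colours w P).
  rewrite !inE => /and4P[wZ _ _ /existsP[a /andP[aQ /existsP[b /andP[bP /eqP e]]]]].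
  by exists (col a w); apply/andP; split; [apply: imset_f|rewrite e; apply: imset_f].
pose c0 := xchoose (exc _ w0D).
(* [phi] picks a page repeated across the cut; the default [c0] is taken only outside [D]. *)
pose phi w := odflt c0 [pick c | (c \in colours w Q) && (c \in colours w P)].
have phiP w : w \in D -> (phi w \in colours w Q) && (phi w \in colours w P).
  move=> /exc ex; rewrite /phi; case: pickP => [//|no].
  by case: ex => c; rewrite no.
have ncc w w' c : w \in Z -> w' \in Z -> pW w < pW w' -> c \in colours w Q -> c \notin colours w' P.
  move=> wZ w'Z lt /imsetP[a aQ ->]; apply/negP=> /imsetP[b bP /eqP].
  by apply/negP; apply: nc.
have DZ w : w \in D -> [/\ w \in Z, pW f < pW w & pW w < pW l].
  by rewrite !inE => /and4P[wZ wf wl _]; split=> //; [apply: ltf|apply: ltl].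
have phi_inj : {in D &, injective phi}.
  move=> w w' wD w'D e; apply: pW_inj; apply/eqP; rewrite eqn_leq.
  have [wZ _ _] := DZ _ wD; have [w'Z _ _] := DZ _ w'D.
  have /andP[q p] := phiP _ wD; have /andP[q' p'] := phiP _ w'D.
  apply/andP; split; rewrite leqNgt; apply/negP=> lt.
    by have := ncc _ _ _ w'Z wZ lt q'; rewrite -e p.
  by have := ncc _ _ _ wZ w'Z lt q; rewrite e p'.
rewrite -(card_in_imset phi_inj); apply: subset_leq_card.
apply/subsetP=> _ /imsetP[w wD ->]; have [wZ fw wl] := DZ _ wD.
have /andP[q p] := phiP _ wD; rewrite !inE negb_or.
rewrite (ncc w l) //=.
have -> : phi w \notin colours f Q by apply/negP=> /(ncc f w _ fZ wZ fw); rewrite p.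
by case/imsetP: q => a aQ ->; apply: ColP => //; rewrite inE aQ.
Qed.

(* Ranks the black vertices in the cyclic order in which they are met from [f];
   [T] exceeds all positions. *)
Definition clockwise (T : nat) (f : W) (b : B) : nat :=
  if pB b < pW f then T + pB b else pB b.

(** On the circle obtained by closing up the spine one meets [w], [w'], [a], [b] in this order, so
    the edges [a w] and [b w'] interleave. Which of them starts further left depends on the sides of
    [a] and [b], hence both orders of the noncrossing hypothesis. *)
Lemma clockwise_noncrossing (T : nat) (f w w' : W) (a b : B) :
  noncrossing_star -> (forall b, pB b < T) -> pW w < pW w' ->
  (forall v x, v \in [:: w; w'] -> x \in [:: a; b] -> (pB x < pW v) = (pB x < pW f)) ->
  clockwise T f a < clockwise T f b -> col a w != col b w'.
Proof.
move=> [_ _ pBW nc] pT lt side kab; apply/eqP=> e.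
have ww' : w != w' by apply: contraTneq lt => ->; rewrite ltnn.
have e1 := side w a; have e2 := side w b; have e3 := side w' a; have e4 := side w' b.
rewrite !inE !eqxx !orbT in e1 e2 e3 e4.
have := nc _ _ _ _ ww' e; have := nc _ _ _ _ _ (esym e); rewrite eq_sym => /(_ ww').
move: kab (e1 isT isT) (e2 isT isT) (e3 isT isT) (e4 isT isT).
have := pBW a w; have := pBW a w'; have := pBW b w; have := pBW b w'.
have := pT a; have := pT b; rewrite /clockwise /cross4.
by case: (ltnP (pB a) (pW f)); case: (ltnP (pB b) (pW f)); lia.
Qed.

End Star.

(* [g] numbers the maximal runs of white vertices (gaps) and [h] the runs of black
   vertices (groups): along the spine one meets group 0, gap 0, group 1, ...,
   gap [A-1], group [A], where the first and the last group may be empty.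
   [f x] and [l x] are the first and last vertices of gap [x]. *)
Record gap_structure (B W : finType) (pB : B -> nat) (pW : W -> nat) (A : nat)
    (g : W -> 'I_A) (h : B -> 'I_A.+1) (f l : 'I_A -> W) : Prop := GapStructure {
  gap_order : forall b w, (pB b < pW w) = (h b <= g w);
  gap_lt : forall w w', g w < g w' -> pW w < pW w';
  group_lt : forall b b', h b < h b' -> pB b < pB b';
  gap_first : forall i, g (f i) = i;
  gap_last : forall i, g (l i) = i;
  gap_range : forall w, pW (f (g w)) <= pW w <= pW (l (g w))
}.

(** A gap is represented by its last vertex: [lasts] collects the white vertices separated by a
    black one from every later white one, and [g], [h] count the elements of [lasts] strictly to the
    left. Distinct gaps have different numbers of black vertices to their left, whence the bound on
    [A]. *)
Lemma exists_gap_structure (B W : finType) (pB : B -> nat) (pW : W -> nat) :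
  injective pW -> (forall b w, pB b != pW w) ->
  exists A, exists (g : W -> 'I_A) (h : B -> 'I_A.+1) (f l : 'I_A -> W),
    gap_structure pB pW g h f l /\ A <= #|B|.+1.
Proof.
move=> pW_inj pBW.
pose lastw w := [forall w', (pW w < pW w') ==> [exists b, pW w < pB b < pW w']].
pose lasts := [set v | lastw v]; pose A := #|lasts|.
pose g0 w := #|[set v in lasts | pW v < pW w]|.
pose h0 b := #|[set v in lasts | pW v < pB b]|.
have last_before b w : pW w < pB b -> exists2 v, v \in lasts & pW w <= pW v < pB b.
  move=> wb; have [v vb vmax] := @arg_maxnP _ w (fun v => pW v < pB b) pW wb.
  exists v; last by rewrite vb andbT; exact: vmax.
  rewrite inE; apply/forallP=> w'; apply/implyP=> vw'; apply/existsP; exists b.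
  rewrite vb /= ltn_neqAle pBW leqNgt; apply/negP=> /vmax/(leq_trans vw').
  by rewrite ltnn.
have last_after w : exists2 v, v \in lasts & pW w <= pW v.
  have [v _ vmax] := @arg_maxnP _ w xpredT pW isT.
  exists v; last exact: vmax.
  rewrite inE; apply/forallP=> w'; apply/implyP; rewrite ltnNge => /negP[]; exact: vmax.
have g0A w : g0 w < A.
  have [v vl wv] := last_after w; apply: proper_card; apply/properP; split.
    by apply/subsetP=> u; rewrite inE => /andP[].
  by exists v; rewrite // inE ltnNge wv andbF.
have h0A b : h0 b < A.+1.
  by rewrite ltnS; apply: subset_leq_card; apply/subsetP=> u; rewrite inE => /andP[].
pose g w : 'I_A := Ordinal (g0A w); pose h b : 'I_A.+1 := Ordinal (h0A b).
have mono (P Q : nat) : P <= Q ->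
    #|[set v in lasts | pW v < P]| <= #|[set v in lasts | pW v < Q]|.
  move=> PQ; apply: subset_leq_card; apply/subsetP=> u; rewrite !inE.
  by case/andP=> -> /leq_trans -> .
have order b w : (pB b < pW w) = (h b <= g w).
  apply/idP/idP=> [lt|]; first by apply: mono; exact: ltnW.
  apply: contraTT; rewrite -leqNgt leq_eqVlt eq_sym (negPf (pBW _ _)) /= => wb.
  have [v vl /andP[wv vb]] := last_before _ _ wb.
  rewrite -ltnNge; apply: proper_card; apply/properP; split.
    by apply/subsetP=> u; rewrite !inE => /andP[-> /ltn_trans ->].
  by exists v; rewrite inE vl //= -leqNgt.
have g_lt w w' : g w < g w' -> pW w < pW w'.
  by apply: contraTT; rewrite -!leqNgt => /mono.
have h_lt b b' : h b < h b' -> pB b < pB b'.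
  by apply: contraTT; rewrite -!leqNgt => /mono.
have g_surj i : exists w, g w == i.
  have g_inj : {in lasts &, injective g}.
    have aux v v' : v \in lasts -> v' \in lasts -> pW v < pW v' -> g v < g v'.
      move=> vl v'l lt; apply: proper_card; apply/properP; split.
        by apply/subsetP=> u; rewrite !inE => /andP[-> /ltn_trans ->].
      by exists v; rewrite inE ?vl ?ltnn ?andbF.
    move=> v v' vl v'l e; apply: pW_inj; case: (ltngtP (pW v) (pW v')) => //.
      by move=> /(aux _ _ vl v'l); rewrite e ltnn.
    by move=> /(aux _ _ v'l vl); rewrite e ltnn.
  have : g @: lasts == setT.
    by rewrite eqEcard subsetT cardsT card_ord (card_in_imset g_inj) leqnn.
  move=> /eqP onto; have := in_setT i; rewrite -onto => /imsetP[w _ iE].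
  by exists w; rewrite iE.
have first i : exists w, (g w = i) /\ forall v, g v = i -> pW w <= pW v.
  have [w0 w0i] := g_surj i.
  have [w /eqP wi wmin] := @arg_minnP _ w0 (fun w => g w == i) pW w0i.
  by exists w; split=> // v /eqP; exact: wmin.
have last i : exists w, (g w = i) /\ forall v, g v = i -> pW v <= pW w.
  have [w0 w0i] := g_surj i.
  have [w /eqP wi wmax] := @arg_maxnP _ w0 (fun w => g w == i) pW w0i.
  by exists w; split=> // v /eqP; exact: wmax.
have [f fP] := fin_all_exists first; have [l lP] := fin_all_exists last.
exists A, g, h, f, l; split.
  split=> // [i|i|w]; [by case: (fP i)|by case: (lP i)|].
  by apply/andP; split; [case: (fP (g w))|case: (lP (g w))] => _; apply.
pose nb w : 'I_#|B|.+1 := inord #|[set b | pB b < pW w]|.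
have nbE w : nb w = #|[set b | pB b < pW w]| :> nat.
  by rewrite inordK // ltnS; exact: max_card.
have aux v v' : v \in lasts -> pW v < pW v' -> nb v < nb v'.
  rewrite inE !nbE => /forallP/(_ v')/implyP H /H{H} /existsP[b /andP[vb bv']].
  apply: proper_card; apply/properP; split.
    by apply/subsetP=> u; rewrite !inE => ub; lia.
  by exists b; rewrite !inE //; lia.
have nb_inj : {in lasts &, injective nb}.
  move=> v v' vl v'l e; apply: pW_inj; case: (ltngtP (pW v) (pW v')) => //.
    by move=> /(aux _ _ vl); rewrite e ltnn.
  by move=> /(aux _ _ v'l); rewrite e ltnn.
by rewrite -(card_ord #|B|.+1) /A -(card_in_imset nb_inj) max_card.
Qed.

(** * Contracting gaps and groups *)

Section Gaps.
Variables (B W : finType) (k D : nat) (col : B -> W -> 'I_k).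
Variables (pB : B -> nat) (pW : W -> nat).
Hypothesis nc : noncrossing_star col pB pW.
Hypothesis cardB : #|B| = k.+1.
Hypothesis few_missing : forall w, k <= #|colours col w setT| + D.
Variables (A : nat) (g : W -> 'I_A) (h : B -> 'I_A.+1) (f l : 'I_A -> W).
Hypothesis gs : gap_structure pB pW g h f l.

Definition black_group (j : 'I_A.+1) : {set B} := [set b | h b == j].

(* Page [c] after contracting every gap and every group to a point. *)
Definition sees (c : 'I_k) (x : 'I_A) (j : 'I_A.+1) : bool :=
  [exists w, exists b, [&& g w == x, h b == j & col b w == c]].

Definition contracted (c : 'I_k) : {set 'I_A * 'I_A.+1} :=
  [set e | sees c e.1 e.2].

Definition left_group (x : 'I_A) : 'I_A.+1 := widen_ord (leqnSn A) x.
Definition right_group (x : 'I_A) : 'I_A.+1 := lift ord0 x.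

Lemma sum_black_group : \sum_j #|black_group j| = #|B|.
Proof.
rewrite -sum1_card (partition_big h xpredT) //=; apply: eq_bigr => j _.
by rewrite -sum1_card; apply: eq_bigl => b; rewrite inE.
Qed.

Lemma card_missing w : #|~: colours col w setT| <= D.
Proof. by have := few_missing w; have := cardsC (colours col w setT); rewrite card_ord; lia. Qed.

Lemma card_colours w (Q : {set B}) : #|colours col w Q| <= #|Q|.
Proof. exact: leq_imset_card. Qed.

(** A page of [S] is either missing at [w], which at most [D] pages are, or used by [w] on [Q],
    which at most [#|Q|] pages are. *)
Lemma card_via_representative (S : {set 'I_k}) w Q :
  (forall c b, c \in S -> col b w = c -> c \in colours col w Q) ->
  #|S| <= #|Q| + D.
Proof.
move=> H; apply: (@leq_trans #|colours col w Q :|: ~: colours col w setT|).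
  apply: subset_leq_card; apply/subsetP=> c cS; rewrite !in_setU in_setC.
  have [/imsetP[b _ cE]|] := boolP (c \in colours col w setT); last by rewrite orbT.
  by rewrite (H c b).
by apply: leq_trans (leq_card_setU _ _).1 _; rewrite leq_add ?card_colours ?card_missing.
Qed.

(** The representative is [f x]: an edge of page [c] from a later vertex of the gap to the group
    just before it encloses [f x], so the edges of page [c] at [f x] end in that group too. *)
Lemma sees_left x : #|[set c | sees c x (left_group x)]| <= #|black_group (left_group x)| + D.
Proof.
have [_ pW_inj pBW ncr] := nc.
apply: (@card_via_representative _ (f x)) => c b'; rewrite inE.
case/existsP=> w /existsP[b /and3P[/eqP wx /eqP bx /eqP cE]] b'c.
have [wf|wf] := eqVneq w (f x).
  by rewrite -cE wf; apply: imset_f; rewrite inE bx.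
rewrite -b'c; apply: imset_f; rewrite inE; apply/eqP/val_inj.
have fw : pW (f x) < pW w.
  rewrite ltn_neqAle (inj_eq pW_inj) eq_sym wf /=.
  by have := gap_range gs w; rewrite wx => /andP[].
have := ncr _ _ _ _ wf (etrans cE (esym b'c)); have := ncr _ _ _ _ _ (esym (etrans cE (esym b'c))).
rewrite eq_sym => /(_ wf); have := gap_order gs b w; have := gap_order gs b' w.
have := gap_order gs b (f x); have := gap_order gs b' (f x).
have := group_lt gs (b := b) (b' := b'); have := group_lt gs (b := b') (b' := b).
have := pBW b w; have := pBW b' (f x); have := pBW b' w.
rewrite (gap_first gs) wx bx /cross4 /=; lia.
Qed.

Lemma sees_right x : #|[set c | sees c x (right_group x)]| <= #|black_group (right_group x)| + D.
Proof.
have [_ pW_inj pBW ncr] := nc.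
apply: (@card_via_representative _ (l x)) => c b'; rewrite inE.
case/existsP=> w /existsP[b /and3P[/eqP wx /eqP bx /eqP cE]] b'c.
have [wf|wf] := eqVneq w (l x).
  by rewrite -cE wf; apply: imset_f; rewrite inE bx.
rewrite -b'c; apply: imset_f; rewrite inE; apply/eqP/val_inj.
have fw : pW w < pW (l x).
  rewrite ltn_neqAle (inj_eq pW_inj) wf /=.
  by have := gap_range gs w; rewrite wx => /andP[].
have := ncr _ _ _ _ wf (etrans cE (esym b'c)); have := ncr _ _ _ _ _ (esym (etrans cE (esym b'c))).
rewrite eq_sym => /(_ wf); have := gap_order gs b w; have := gap_order gs b' w.
have := gap_order gs b (l x); have := gap_order gs b' (l x).
have := group_lt gs (b := b) (b' := b'); have := group_lt gs (b := b') (b' := b).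
have := pBW b w; have := pBW b' (l x); have := pBW b' w; have := pBW b (l x).
rewrite (gap_last gs) wx bx /cross4 /= /bump /=; lia.
Qed.

Definition boundary : {set 'I_A * 'I_A.+1} :=
  [set (x, left_group x) | x : 'I_A] :|: [set (x, right_group x) | x : 'I_A].

Lemma card_boundary : #|boundary| = 2 * A.
Proof.
rewrite /boundary cardsU disjoint_setI0 ?cards0.
  rewrite !card_imset ?card_ord; first by lia.
  - by move=> x y [].
  - by move=> x y [].
apply/pred0P=> e /=; apply/negP=> /andP[/imsetP[x _ ->] /imsetP[y _]].
move=> /(congr1 (fun e : 'I_A * 'I_A.+1 => (val e.1, val e.2))) /= [] ->.
by rewrite /bump /=; lia.
Qed.

(* The pairs of [boundary] are consecutive on the spine, so adding them to a
   contracted page creates no crossing. *)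
Lemma card_contracted c : #|contracted c| + 2 * A <= 3 * A + 1 + #|contracted c :&: boundary|.
Proof.
(* On the contracted spine gap [x] is at [2 x + 1] and group [j] at [2 j]. *)
have := @planar_bipartite 'I_A 'I_A.+1 (fun x => x.*2.+1) (fun j => j.*2)
   _ _ _ (contracted c :|: boundary).
have -> : 2 * A = #|boundary| by rewrite card_boundary.
rewrite !card_ord => H.
have {}H : 2 * #|contracted c :|: boundary| <= 3 * (A + A.+1).
  apply: H => [x y|x y|x y|].
  - by move=> [] /double_inj /val_inj.
  - by move=> /double_inj /val_inj.
  - by apply/eqP=> /(congr1 odd); rewrite /= !odd_double.
  have bd e : e \in boundary -> (e.2 = e.1 :> nat) \/ (e.2 = e.1.+1 :> nat).
    by rewrite inE => /orP[] /imsetP[x _ ->] /=; [left|right].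
  move=> e e' He He'.
  have [/bd|eb] := boolP (e \in boundary); first by rewrite /cross4 /=; lia.
  have [/bd|e'b] := boolP (e' \in boundary); first by rewrite /cross4 /=; lia.
  move: He He'; rewrite in_setU (negPf eb) in_setU (negPf e'b) !orbF !inE.
  case: e e' {eb e'b} => [x j] [x' j'] /=.
  case/existsP=> w /existsP[b /and3P[/eqP<- /eqP<- /eqP cE]].
  case/existsP=> w' /existsP[b' /and3P[/eqP<- /eqP<- /eqP c'E]].
  have [_ pW_inj pBW ncr] := nc.
  have [->|ww'] := eqVneq w w'; first by rewrite /cross4 /=; lia.
  have := ncr _ _ _ _ ww' (etrans cE (esym c'E)); apply: contra.
  have := gap_order gs b w; have := gap_order gs b' w.
  have := gap_order gs b w'; have := gap_order gs b' w'.
  have := group_lt gs (b := b) (b' := b'); have := group_lt gs (b := b') (b' := b).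
  have := gap_lt gs (w := w) (w' := w'); have := gap_lt gs (w := w') (w' := w).
  have := pBW b w; have := pBW b w'; have := pBW b' w; have := pBW b' w'.
  rewrite /cross4; lia.
have := cardsUI (contracted c) boundary; lia.
Qed.

(** [card_contracted] allows [A + 1] pairs per page plus the adjacent pairs seen. The latter are few
    in total by [sees_left] and [sees_right], since a group is adjacent to at most two gaps. *)
Lemma sum_contracted : \sum_c #|contracted c| <= k * A + k + 2 * k.+1 + 2 * D * A.
Proof.
have : \sum_c #|contracted c :&: boundary| <= 2 * k.+1 + 2 * D * A.
  apply: (@leq_trans (\sum_(c : 'I_k) \sum_x (sees c x (left_group x) + sees c x (right_group x)))).
    apply: leq_sum => c _; rewrite big_split /=.
    rewrite setIUr; apply: leq_trans (leq_card_setU _ _).1 _; apply: leq_add.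
      rewrite (_ : _ :&: _ = [set (x, left_group x) | x in [set x | sees c x (left_group x)]]).
        apply: leq_trans (leq_imset_card _ _) _; rewrite -sum1_card big_mkcond /=.
        by apply: leq_sum => x _; rewrite inE; case: sees.
      apply/setP=> e; apply/setIP/imsetP=> [[]|[x]].
        by rewrite inE => + /imsetP[x _ eE]; rewrite eE /= => s; exists x; rewrite ?inE.
      by rewrite inE => s ->; rewrite inE /= s; split=> //; apply: imset_f.
    rewrite (_ : _ :&: _ = [set (x, right_group x) | x in [set x | sees c x (right_group x)]]).
      apply: leq_trans (leq_imset_card _ _) _; rewrite -sum1_card big_mkcond /=.
      by apply: leq_sum => x _; rewrite inE; case: sees.
    apply/setP=> e; apply/setIP/imsetP=> [[]|[x]].
      by rewrite inE => + /imsetP[x _ eE]; rewrite eE /= => s; exists x; rewrite ?inE.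
    by rewrite inE => s ->; rewrite inE /= s; split=> //; apply: imset_f.
  rewrite exchange_big /=.
  apply: (@leq_trans (\sum_x ((#|black_group (left_group x)| + D) + (#|black_group (right_group x)| + D)))).
    apply: leq_sum => x _; rewrite big_split /=; apply: leq_add.
      apply: leq_trans (sees_left x); rewrite -sum1_card [leqRHS]big_mkcond /=.
      by apply: leq_sum => c _; rewrite inE; case: sees.
    apply: leq_trans (sees_right x); rewrite -sum1_card [leqRHS]big_mkcond /=.
    by apply: leq_sum => c _; rewrite inE; case: sees.
  rewrite !big_split /= !sum_nat_const card_ord.
  have S1 : \sum_x #|black_group (left_group x)| <= k.+1.
    by rewrite -cardB -sum_black_group big_ord_recr leq_addr.
  have S2 : \sum_x #|black_group (right_group x)| <= k.+1.
    by rewrite -cardB -sum_black_group big_ord_recl leq_addl.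
  by rewrite addnACA; apply: leq_trans (leq_add (leq_add S1 S2) (leqnn _)) _; lia.
have : \sum_c (#|contracted c| + 2 * A) <= \sum_c (3 * A + 1 + #|contracted c :&: boundary|).
  by apply: leq_sum => c _; exact: card_contracted.
rewrite !big_split /= !sum_nat_const card_ord; nia.
Qed.

Lemma sum_colours w : k <= \sum_j #|colours col w (black_group j)| + D.
Proof.
apply: leq_trans (few_missing w) _; rewrite leq_add2r.
apply: (@leq_trans #|\bigcup_j colours col w (black_group j)|).
  apply: subset_leq_card; apply/subsetP=> c /imsetP[b _ ->].
  by apply/bigcupP; exists (h b) => //; apply: imset_f; rewrite inE.
elim/big_rec2: _ => [|j s U _ IH]; first by rewrite cards0.
by apply: leq_trans (leq_card_setU _ _).1 _; rewrite leq_add2l.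
Qed.

Definition seen (x : 'I_A) (j : 'I_A.+1) : {set 'I_k} := [set c | sees c x j].

(* Bounds the number of white vertices of gap [x] repeating a page across a given
   cut of group [j], see [gap_flux]. *)
Definition capacity (x : 'I_A) (j : 'I_A.+1) : nat :=
  #|seen x j| - #|colours col (f x) (black_group j)| + (#|black_group j| - #|colours col (l x) (black_group j)|).

Lemma sum_seen : \sum_x \sum_j #|seen x j| = \sum_c #|contracted c|.
Proof.
have -> : \sum_x \sum_j #|seen x j| = \sum_x \sum_j \sum_c (sees c x j : nat).
  apply: eq_bigr => x _; apply: eq_bigr => j _; rewrite -sum1_card big_mkcond /=.
  by apply: eq_bigr => c _; rewrite inE; case: sees.
rewrite pair_big exchange_big /=; apply: eq_bigr => c _.
rewrite -sum1_card [RHS]big_mkcond /=; apply: eq_bigr => e _.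
by rewrite inE; case: sees.
Qed.

(** Both truncated subtractions in [capacity] are exact. *)
Lemma capacityE x j :
  capacity x j + (#|colours col (f x) (black_group j)| + #|colours col (l x) (black_group j)|)
    = #|seen x j| + #|black_group j|.
Proof.
have := card_colours (l x) (black_group j).
have : #|colours col (f x) (black_group j)| <= #|seen x j|.
  apply: subset_leq_card; apply/subsetP=> c /imsetP[b]; rewrite !inE => bj ->.
  by apply/existsP; exists (f x); apply/existsP; exists b; rewrite (gap_first gs) !eqxx bj.
rewrite /capacity; lia.
Qed.

(** In each gap the group sizes add up to [k + 1], and the pages at each of [f x] and [l x] to at
    least [k - D]. With [sum_contracted] for the pages seen, the terms of order [k A] cancel. *)
Lemma sum_capacity : \sum_x \sum_j capacity x j <= 3 * k + 2 + 4 * D * A + A.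
Proof.
have : \sum_x (\sum_j capacity x j + 2 * k) <= \sum_x (\sum_j #|seen x j| + k.+1 + 2 * D).
  apply: leq_sum => x _; rewrite -cardB -sum_black_group -big_split /=.
  rewrite -(eq_bigr _ (fun j _ => capacityE x j)) !big_split /=.
  have := sum_colours (f x); have := sum_colours (l x).
  move: (\sum_j #|colours col (f x) (black_group j)|) (\sum_j #|colours col (l x) (black_group j)|) => s1 s2; lia.
rewrite !big_split /= !sum_nat_const card_ord sum_seen.
have := sum_contracted; nia.
Qed.

Let T := (\max_b pB b).+1.
Let pT b : pB b < T. Proof. by rewrite ltnS; exact: leq_bigmax. Qed.

Lemma side_eq x w b : g w = x -> (pB b < pW w) = (pB b < pW (f x)).
Proof. by move=> gw; rewrite !(gap_order gs) (gap_first gs) gw. Qed.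

Lemma gap_noncrossing x w w' a b : g w = x -> g w' = x -> pW w < pW w' ->
  clockwise pB pW T (f x) a < clockwise pB pW T (f x) b -> col a w != col b w'.
Proof.
move=> gw gw' ww'; apply: clockwise_noncrossing nc pT ww' _ => v y.
by rewrite !inE => /orP[] /eqP-> _; exact: side_eq.
Qed.

Definition dup_over (x : 'I_A) (a : B) : {set W} :=
  [set w | [&& g w == x, w != f x, w != l x & [exists a', exists b', [&& h a' == h a,
     h b' == h a, pB a' <= pB a, pB a < pB b' & col a' w == col b' w]]]].

(** [flux] for the cut of the group after [a]. Passing to the whole group costs at most [#|P|] pages
    at [f x] and at most [#|Q|] at [l x], which makes the bound independent of the place of the
    cut. *)
Lemma gap_flux x a : #|dup_over x a| <= capacity x (h a).
Proof.
set Z := [set w | g w == x]; set Q := [set b in black_group (h a) | pB b <= pB a].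
set P := [set b in black_group (h a) | pB a < pB b].
have QP : black_group (h a) = Q :|: P.
  by apply/setP=> b; rewrite !inE -andb_orr leqNgt orNb andbT.
have fl : #|[set w in Z | [&& w != f x, w != l x & [exists a in Q, exists b in P, col a w == col b w]]]|
    <= #|seen x (h a)| - #|colours col (f x) Q| - #|colours col (l x) P|.
  apply: (flux (pW := pW)).
  - by have [_ pW_inj _ _] := nc.
  - by rewrite inE (gap_first gs).
  - by rewrite inE (gap_last gs).
  - by move=> w; rewrite inE => /eqP<-; exact: (gap_range gs).
  - move=> w w' a' b'; rewrite !inE => /eqP gw /eqP gw' ww' /andP[/eqP a'j la] /andP[/eqP b'j lb].
    apply: gap_noncrossing gw gw' ww' _.
    rewrite /clockwise !(gap_order gs) a'j b'j; case: ifP => _; lia.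
  - move=> w b; rewrite -QP !inE => gw bj; apply/existsP; exists w; apply/existsP; exists b.
    by rewrite gw bj eqxx.
apply: leq_trans (leq_trans _ fl) _.
  apply: subset_leq_card; apply/subsetP=> w; rewrite !inE.
  case/and4P=> -> -> -> /existsP[a' /existsP[b' /and5P[a'j b'j la lb e]]] /=.
  by apply/existsP; exists a'; rewrite !inE a'j la /=; apply/existsP; exists b'; rewrite !inE b'j lb.
have : #|black_group (h a)| = #|Q| + #|P|.
  rewrite QP cardsU disjoint_setI0 ?cards0 ?subn0 //.
  by apply/pred0P=> b; rewrite !inE; lia.
have col_split w (Q' P' : {set B}) : #|colours col w (Q' :|: P')| <= #|colours col w Q'| + #|P'|.
  rewrite /colours imsetU; apply: leq_trans (leq_card_setU _ _).1 _.
  by rewrite leq_add2l leq_imset_card.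
have := col_split (f x) Q P; have := col_split (l x) P Q.
rewrite -[P :|: Q]setUC -QP; have := capacityE x (h a); lia.
Qed.

Lemma card_cover (I U : finType) (P : pred I) (F : I -> {set U}) (S : {set U}) :
  (forall u, u \in S -> exists2 i, P i & u \in F i) -> #|S| <= \sum_(i | P i) #|F i|.
Proof.
move=> SF; apply: (@leq_trans #|\bigcup_(i | P i) F i|).
  apply: subset_leq_card; apply/subsetP=> u /SF[i Pi uF]; apply/bigcupP; by exists i.
elim/big_rec2: _ => [|i s V _ IH]; first by rewrite cards0.
by apply: leq_trans (leq_card_setU _ _).1 _; rewrite leq_add2l.
Qed.

(** * Pages repeated inside small groups *)

Variable z : nat.

Definition small_dup : {set W} := [set w | [&& w != f (g w), w != l (g w) &
  [exists a, exists b, [&& h b == h a, pB a < pB b, col a w == col b w & #|black_group (h a)| <= z]]]].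

(** A small group has at most [z] cuts, and from each gap every cut costs at most the capacity;
    hence [z] times [sum_capacity]. *)
Lemma card_small_dup : #|small_dup| <= z * (3 * k + 2 + 4 * D * A + A).
Proof.
apply: leq_trans (leq_mul (leqnn z) sum_capacity).
apply: (@leq_trans (\sum_(i : 'I_A * B | #|black_group (h i.2)| <= z) capacity i.1 (h i.2))).
  apply: (@leq_trans (\sum_(i : 'I_A * B | #|black_group (h i.2)| <= z) #|dup_over i.1 i.2|));
    last by apply: leq_sum => i _; exact: gap_flux.
  apply: card_cover => w; rewrite inE => /and3P[wf wl].
  case/existsP=> a /existsP[b /and4P[bj ab e sz]]; exists (g w, a) => //.
  rewrite inE /= eqxx wf wl /=; apply/existsP; exists a; apply/existsP; exists b.
  by rewrite eqxx bj leqnn ab.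
rewrite -(pair_big xpredT (fun a => #|black_group (h a)| <= z) (fun x a => capacity x (h a))) /=.
rewrite big_distrr; apply: leq_sum => x _.
rewrite (partition_big h xpredT) //= big_distrr /=; apply: leq_sum => j _.
rewrite (eq_bigr (fun _ => capacity x j)); last by move=> b /andP[_ /eqP->].
rewrite sum_nat_const; have [jz|jz] := leqP #|black_group j| z.
  rewrite leq_mul2r; apply/orP; right; apply: leq_trans jz.
  by apply: subset_leq_card; apply/subsetP=> b; rewrite !inE => /andP[].
rewrite eq_card0 // => b; rewrite !inE; apply/negP=> /andP[+ /eqP hb].
by rewrite hb leqNgt jz.
Qed.

(** * Pages repeated on two groups *)

Definition across_dup : {set W} :=
  [set w | [exists a, exists b, (h a != h b) && (col a w == col b w)]].

Definition across_at (x : 'I_A) (c : 'I_k) : {set W} :=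
  [set w | (g w == x) && [exists a, exists b, [&& h a != h b, col a w == c & col b w == c]]].

(** If the set is nonempty, at least two groups are seen, so injecting it into the groups seen
    suffices. Map [w] to the group of [low w], its clockwise first neighbour in page [c]. A later
    [w'] has a neighbour [d] in another group; [d] cannot come after [low w], so [low w'] lies in an
    earlier group. *)
Lemma card_across_gap x c :
  #|across_at x c| <= 2 * (#|[set j | sees c x j]| - 1).
Proof.
set Z := across_at x c; case: (set_0Vmem Z) => [->|[w0 w0Z]]; first by rewrite cards0.
have r2 : 1 < #|[set j | sees c x j]|.
  move: w0Z; rewrite inE => /andP[gw /existsP[a /existsP[b /and3P[hab ca cb]]]].
  apply: (@leq_trans #|[set h a; h b]|); first by rewrite cards2 hab.
  apply: subset_leq_card; apply/subsetP=> j; rewrite !inE => /orP[] /eqP->;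
  apply/existsP; exists w0; apply/existsP; [exists a|exists b];
  by rewrite gw eqxx ?ca ?cb.
suff : #|Z| <= #|[set j | sees c x j]| by lia.
pose kap := clockwise pB pW T (f x).
have [b0 _] : exists b0 : B, true.
  by move: w0Z; rewrite inE => /andP[_ /existsP[a _]]; exists a.
have lowP w : exists a, w \in Z -> col a w = c /\ forall b, col b w = c -> kap a <= kap b.
  have [wZ|] := boolP (w \in Z); last by exists b0.
  have [a ca] : exists a, col a w == c.
    by move: wZ; rewrite inE => /andP[_ /existsP[a /existsP[b /and3P[_ ca _]]]]; exists a.
  have [a' /eqP ca' amin] := @arg_minnP _ a (fun a => col a w == c) kap ca.
  by exists a' => _; split=> // b /eqP; exact: amin.
have [low lowE] := fin_all_exists lowP.
have low_ne w w' : w \in Z -> w' \in Z -> pW w < pW w' -> h (low w) != h (low w').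
  move=> wZ w'Z ww'; apply/eqP=> e.
  have [cw _] := lowE w wZ; have [_ minw'] := lowE w' w'Z.
  have gw : g w = x by move: wZ; rewrite inE => /andP[/eqP].
  move: w'Z; rewrite inE => /andP[/eqP gw' /existsP[a /existsP[b /and3P[hab /eqP ca /eqP cb]]]].
  have [d hd cd] : exists2 d, h d != h (low w) & col d w' = c.
    have [ha|ha] := eqVneq (h a) (h (low w)); last by exists a.
    by exists b; rewrite // -ha eq_sym.
  have := @gap_noncrossing x w w' (low w) d gw gw' ww'; rewrite cw cd eqxx -/kap => k1.
  have {}k1 : kap d <= kap (low w) by rewrite leqNgt; apply/negP=> /k1.
  have := minw' _ cd; move: k1 hd; rewrite /kap /clockwise !(gap_order gs) -e.
  have := group_lt gs (b := d) (b' := low w); have := group_lt gs (b := low w) (b' := d).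
  have := group_lt gs (b := d) (b' := low w'); have := group_lt gs (b := low w') (b' := d).
  rewrite -e; have := pT d; have := pT (low w); have := pT (low w').
  rewrite -(inj_eq val_inj) /= neq_ltn.
  have := gap_order gs d (f x); have := gap_order gs (low w) (f x).
  have := gap_order gs (low w') (f x); rewrite -e.
  by case: (leqP (h d) (g (f x))); case: (leqP (h (low w)) (g (f x))); lia.
have low_inj : {in Z &, injective (h \o low)}.
  move=> w w' wZ w'Z /= e; have [_ pW_inj _ _] := nc; apply: pW_inj.
  case: (ltngtP (pW w) (pW w')) => //.
    by move=> /(low_ne _ _ wZ w'Z); rewrite e eqxx.
  by move=> /(low_ne _ _ w'Z wZ); rewrite e eqxx.
rewrite -(card_in_imset low_inj); apply: subset_leq_card.
apply/subsetP=> _ /imsetP[w wZ ->]; rewrite inE; apply/existsP; exists w.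
apply/existsP; exists (low w); have [-> _] := lowE w wZ.
by move: wZ; rewrite inE => /andP[-> _]; rewrite !eqxx.
Qed.

(** At least [k - D] pages are used by [f x] and so see a group; for these the truncated [- 1]
    really subtracts. Summed over the gaps this cancels the term [k A] of [sum_contracted]. *)
Lemma card_across_dup : #|across_dup| <= 2 * (3 * k + 2 + 3 * D * A).
Proof.
apply: (@leq_trans (\sum_(i : 'I_A * 'I_k) 2 * (#|[set j | sees i.2 i.1 j]| - 1))).
  apply: (@leq_trans (\sum_(i : 'I_A * 'I_k) #|across_at i.1 i.2|));
    last by apply: leq_sum => i _; exact: card_across_gap.
  apply: card_cover => w; rewrite inE => /existsP[a /existsP[b /andP[hab /eqP e]]].
  exists (g w, col a w) => //; rewrite inE eqxx /=; apply/existsP; exists a.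
  by apply/existsP; exists b; rewrite hab e eqxx.
rewrite -big_distrr leq_mul2l /=.
rewrite -(pair_big xpredT xpredT (fun x c => #|[set j | sees c x j]| - 1)) /=.
have : \sum_x (\sum_c (#|[set j | sees c x j]| - 1) + k) <= \sum_x (\sum_c #|[set j | sees c x j]| + D).
  apply: leq_sum => x _; have := few_missing (f x).
  suff : \sum_c (#|[set j | sees c x j]| - 1) + #|colours col (f x) setT| <= \sum_c #|[set j | sees c x j]| by lia.
  rewrite -sum1_card [X in _ + X <= _]big_mkcond /= -big_split /=; apply: leq_sum => c _.
  case: ifP => [/imsetP[b _ ->]|_]; last by rewrite addn0 leq_subr.
  rewrite subnK // card_gt0; apply/set0Pn; exists (h b); rewrite inE.
  by apply/existsP; exists (f x); apply/existsP; exists b; rewrite (gap_first gs) !eqxx.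
have -> : \sum_x (\sum_c #|[set j | sees c x j]| + D) = \sum_c #|contracted c| + A * D.
  rewrite big_split /= sum_nat_const card_ord; congr addn.
  rewrite exchange_big; apply: eq_bigr => c _ /=; rewrite -[RHS]sum1_card [RHS]big_mkcond /=.
  rewrite (eq_bigr (fun x => \sum_j (sees c x j : nat))); last first.
    move=> x _; rewrite -sum1_card big_mkcond /=; apply: eq_bigr => j _.
    by rewrite inE; case: sees.
  by rewrite pair_big; apply: eq_bigr => e _; rewrite inE; case: sees.
rewrite big_split /= sum_nat_const card_ord; move: sum_contracted.
move: (\sum_c #|contracted c|) (\sum_x \sum_c (#|[set j | sees c x j]| - 1)) => s t; nia.
Qed.

(** * Pages repeated inside big groups *)

Definition big_groups : {set 'I_A.+1} := [set j | z < #|black_group j|].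

(* Windows are the parts of the spine delimited by the big groups. *)
Definition gap_window (w : W) : 'I_#|big_groups|.+1 :=
  inord #|[set j in big_groups | j <= g w]|.

Definition window (v : 'I_#|big_groups|.+1) : {set B} :=
  [set b | (h b \notin big_groups) && (inord #|[set j in big_groups | j <= h b]| == v)].

Definition big_blacks : {set B} := [set b | h b \in big_groups].

(** Keeps the arguments of [inord] in [gap_window] and [window] in range. *)
Lemma big_groups_before n : #|[set j in big_groups | (j : 'I_A.+1) <= n]| < #|big_groups|.+1.
Proof. by rewrite ltnS; apply: subset_leq_card; apply/subsetP=> j; rewrite inE => /andP[]. Qed.

(** If [b] lay between [w'] and [w], the number of big groups up to [h b] would be squeezed between
    equal numbers; then [b] would be in no big group, hence in their window. *)
Lemma window_side w w' b : gap_window w = gap_window w' -> b \notin window (gap_window w) ->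
  h b <= g w -> h b <= g w'.
Proof.
move=> ww' bn bw; rewrite leqNgt; apply/negP=> w'b.
pose F n := [set j in big_groups | (j : 'I_A.+1) <= n].
have FE : #|F (g w)| = #|F (g w')|.
  by have := congr1 val ww'; rewrite /= !inordK // big_groups_before.
have sub n n' : n <= n' -> F n \subset F n'.
  by move=> nn; apply/subsetP=> j; rewrite !inE => /andP[-> /leq_trans ->].
have Fb : #|F (h b)| = #|F (g w)|.
  by apply/eqP; rewrite eqn_leq {2}FE !subset_leq_card ?sub // ltnW.
have bb : h b \notin big_groups.
  apply/negP=> bb; have : F (g w') \proper F (g w).
    apply/properP; split; first by apply: sub; lia.
    by exists (h b); rewrite inE bb /= // -ltnNge.
  by move/proper_card; rewrite FE ltnn.
by move: bn; rewrite inE bb /= -[#|[set j in _ | _]|]/#|F (h b)| Fb eqxx.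
Qed.

Definition window_dup (v : 'I_#|big_groups|.+1) (a : B) : {set W} :=
  [set w | (gap_window w == v) && [exists b, [&& h b == h a, pB a < pB b & col a w == col b w]]].

(** [flux] for the black vertices outside the window, cut clockwise after [a], with all [k] pages
    allowed. As a white vertex uses at least [k - D] pages on [k + 1] edges, at most [D + 1] are
    lost on each of [Q] and [P]; this leaves [#|window v| + 2 D + 1], and [f0], [l0] add 2. *)
Lemma card_window_dup v a : h a \in big_groups ->
  #|window_dup v a| <= #|window v| + 2 * D + 3.
Proof.
move=> abig; pose Z := [set w | gap_window w == v].
case: (set_0Vmem Z) => [Z0|[w0 w0Z]].
  rewrite (_ : window_dup v a = set0) ?cards0 //; apply/setP=> w; have := in_set0 w.
  by rewrite -Z0 !inE => ->.
have [f0 f0Z fmin] := @arg_minnP _ w0 (fun w => w \in Z) pW w0Z.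
have [l0 l0Z lmax] := @arg_maxnP _ w0 (fun w => w \in Z) pW w0Z.
pose kap := clockwise pB pW T f0.
pose Q := [set b in ~: window v | kap b <= kap a]; pose P := [set b in ~: window v | kap a < kap b].
have QP : ~: window v = Q :|: P.
  by rewrite /Q /P; move: (~: window v) => O; apply/setP=> b; rewrite !inE -andb_orr leqNgt orNb andbT.
have cQP : #|Q| + #|P| + #|window v| = k.+1.
  rewrite -cardB -(cardsC (window v)) QP cardsU disjoint_setI0 ?cards0 ?subn0; first by lia.
  by apply/pred0P=> b; rewrite !inE; lia.
have side w b : w \in Z -> b \notin window v -> (pB b < pW w) = (pB b < pW f0).
  rewrite inE => /eqP wv bv; have f0v : gap_window f0 = v by apply/eqP; move: f0Z; rewrite inE.
  rewrite !(gap_order gs); apply/idP/idP; apply: window_side; rewrite ?wv ?f0v //.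
have out b : h b = h a -> b \notin window v by move=> ba; rewrite inE ba abig.
have fl : #|[set w in Z | [&& w != f0, w != l0 & [exists a in Q, exists b in P, col a w == col b w]]]|
    <= #|[set: 'I_k]| - #|colours col f0 Q| - #|colours col l0 P|.
  apply: (flux (pW := pW)) => //.
  - by have [_ pW_inj _ _] := nc.
  - by move=> w wZ; apply/andP; split; [exact: fmin|exact: lmax].
  - move=> w w' a' b' wZ w'Z ww'; rewrite in_set in_setC => /andP[a'v la].
    rewrite in_set in_setC => /andP[b'v lb].
    apply: clockwise_noncrossing nc pT ww' _ (leq_ltn_trans la lb) => u y.
    by rewrite !in_cons !in_nil !orbF => /orP[] /eqP-> /orP[] /eqP->; apply: side.
  - by move=> w b _ _; rewrite in_setT.
have colb w (S : {set B}) : #|S| <= #|colours col w S| + D.+1.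
  have : #|colours col w setT| <= #|colours col w S| + #|~: S|.
    rewrite -(setUCr S) /colours imsetU; apply: leq_trans (leq_card_setU _ _).1 _.
    by rewrite leq_add2l leq_imset_card.
  by have := cardsC S; have := few_missing w; rewrite cardB; lia.
have sub : window_dup v a \subset [set w in Z | [&& w != f0, w != l0
    & [exists a in Q, exists b in P, col a w == col b w]]] :|: [set f0; l0].
  apply/subsetP=> w; rewrite !inE => /andP[wv /existsP[b /and3P[/eqP ba ab e]]].
  have [->|wf] := eqVneq w f0; first by rewrite orbT.
  have [->|wl] := eqVneq w l0; first by rewrite !orbT.
  rewrite wv /= orbF; apply/existsP; exists a; rewrite in_set in_setC out //= leqnn /=.
  apply/existsP; exists b; rewrite in_set in_setC out // e /= andbT.
  by rewrite /kap /clockwise !(gap_order gs) ba; case: ifP => _; lia.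
have := leq_trans (subset_leq_card sub) (leq_card_setU _ _).1.
have : #|[set f0; l0]| <= 2 by rewrite cards2; case: eqP.
have := colb f0 Q; have := colb l0 P; move: fl; rewrite cardsT card_ord; lia.
Qed.

Definition big_dup : {set W} :=
  [set w | [exists a, exists b, [&& h b == h a, pB a < pB b, col a w == col b w & h a \in big_groups]]].

(** Sum [card_window_dup] over the windows and the vertices of big groups; the windows partition the
    other black vertices. *)
Lemma card_big_dup :
  #|big_dup| <= #|big_blacks| * (k.+1 - #|big_blacks| + #|big_groups|.+1 * (2 * D + 3)).
Proof.
apply: (@leq_trans (\sum_(i : 'I_#|big_groups|.+1 * B | h i.2 \in big_groups) #|window_dup i.1 i.2|)).
  apply: card_cover => w; rewrite inE => /existsP[a /existsP[b /and4P[ba ab e abig]]].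
  exists (gap_window w, a) => //; rewrite inE eqxx /=; apply/existsP; exists b.
  by rewrite ba ab e.
rewrite -(pair_big xpredT (fun a => h a \in big_groups) (fun v a => #|window_dup v a|)) /=.
rewrite exchange_big /= -sum_nat_const [leqLHS](eq_bigl (fun b => b \in big_blacks)); last by move=> b; rewrite !inE.
apply: leq_sum => a; rewrite inE => abig.
apply: (@leq_trans (\sum_v (#|window v| + (2 * D + 3)))).
  by apply: leq_sum => v _; rewrite addnA card_window_dup.
rewrite big_split /= sum_nat_const card_ord leq_add2r.
have -> : k.+1 - #|big_blacks| = #|~: big_blacks| by rewrite -cardB -(cardsC big_blacks) addKn.
rewrite -[X in _ <= X]sum1_card (partition_big (fun b => inord #|[set j in big_groups | j <= h b]| : 'I_#|big_groups|.+1) xpredT) //=.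
apply: leq_sum => v _; rewrite -sum1_card; apply: eq_leq; apply: eq_bigl => b.
by rewrite !inE.
Qed.

Lemma card_big_groups : #|big_groups| * z <= k.+1.
Proof.
rewrite -cardB -sum_black_group -sum_nat_const [leqRHS](bigID (mem big_groups)) /=.
apply: leq_trans (leq_addr _ _); apply: leq_sum => j; rewrite inE; exact: ltnW.
Qed.

(** By pigeonhole a white vertex repeats a page, on two groups, in a small group or in a big one.
    The ends of the gaps, left out of [small_dup], give the term [2 A]. *)
Lemma card_whites_by_gaps :
  #|W| <= 2 * A + z * (3 * k + 2 + 4 * D * A + A) + 2 * (3 * k + 2 + 3 * D * A)
    + #|big_blacks| * (k.+1 - #|big_blacks| + #|big_groups|.+1 * (2 * D + 3)).
Proof.
rewrite -cardsT.
have sub : [set: W] \subset (f @: setT :|: l @: setT) :|: small_dup :|: across_dup :|: big_dup.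
  apply/subsetP=> w _; rewrite !in_setU.
  have [|wf] := boolP (w \in f @: _) => //=; have [|wl] := boolP (w \in l @: _) => //=.
  have [a [b [ab e]]] : exists a b, pB a < pB b /\ col a w = col b w.
    have : ~~ injectiveb (fun b => col b w).
      apply/injectiveP=> inj; have := max_card (mem (codom (fun b => col b w))).
      by rewrite card_codom // cardB card_ord ltnn.
    case/injectivePn=> a [b ab e]; have [pB_inj _ _ _] := nc.
    case: (ltngtP (pB a) (pB b)) => [lt|lt|/pB_inj eq]; [by exists a, b|by exists b, a|by rewrite eq eqxx in ab].
  have [hab|hab] := eqVneq (h b) (h a); last first.
    apply/orP; left; apply/orP; right; rewrite inE; apply/existsP; exists b; apply/existsP; exists a.
    by rewrite hab e eqxx.
  have [sm|bg] := leqP #|black_group (h a)| z.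
    apply/orP; left; apply/orP; left; rewrite inE; apply/and3P; split.
    - by apply: contraNneq wf => ->; exact: imset_f.
    - by apply: contraNneq wl => ->; exact: imset_f.
    by apply/existsP; exists a; apply/existsP; exists b; rewrite hab ab e sm !eqxx.
  apply/orP; right; rewrite inE; apply/existsP; exists a; apply/existsP; exists b.
  by rewrite hab ab e !eqxx inE.
apply: leq_trans (subset_leq_card sub) _.
apply: leq_trans (leq_card_setU _ _).1 (leq_add _ card_big_dup).
apply: leq_trans (leq_card_setU _ _).1 (leq_add _ card_across_dup).
apply: leq_trans (leq_card_setU _ _).1 (leq_add _ card_small_dup).
apply: leq_trans (leq_card_setU _ _).1 _; rewrite mul2n -addnn.
by apply: leq_add; apply: leq_trans (leq_imset_card _ _) _; rewrite cardsT card_ord.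
Qed.

Lemma card_big_blacks : #|big_blacks| <= k.+1.
Proof. by rewrite -cardB max_card. Qed.
End Gaps.

(** * Discarding the white vertices that miss many pages *)

Section PagesBound.
Variables (B W : finType) (k D : nat) (col : B -> W -> 'I_k).
Variables (pB : B -> nat) (pW : W -> nat).
Hypothesis nc : noncrossing_star col pB pW.
Hypothesis cardB : #|B| = k.+1.

Definition many_missing : {set W} := [set w | #|colours col w setT| + D < k].

(** Such a vertex has [k + 1] edges on at most [k - D - 1] pages, an excess of at least [D + 2];
    [planar_page_excess] bounds the total excess by [6 (k + 1)] per page. *)
Lemma card_many_missing : #|many_missing| * (D + 2) <= 6 * k * k.+1.
Proof.
have [pB_inj pW_inj pBW ncr] := nc.
pose deg c w := #|[set b | col b w == c]|.
have page c : \sum_w (deg c w - 1) <= 6 * k.+1.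
  rewrite -cardB; apply: planar_page_excess pB_inj pW_inj pBW _ => a w b w' /eqP ca /eqP cb.
  have [->|ww'] := eqVneq w w'; first by rewrite /cross4; lia.
  by apply: ncr ww' _; rewrite ca cb.
have excess w : k.+1 <= \sum_c (deg c w - 1) + #|colours col w setT|.
  rewrite -cardB -[leqLHS]sum1_card (partition_big (fun b => col b w) xpredT) //=.
  have -> : #|colours col w setT| = \sum_c (c \in colours col w setT).
    by rewrite -sum1_card big_mkcond /=; apply: eq_bigr => c _; case: (c \in _).
  rewrite -big_split /=.
  apply: leq_sum => c _.
  have -> : \sum_(b | col b w == c) 1 = deg c w.
    by rewrite /deg -sum1_card; apply: eq_bigl => b; rewrite inE.
  case: (boolP (c \in _)) => [_|cn]; first by lia.
  suff -> : deg c w = 0 by [].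
  apply/eqP; rewrite cards_eq0; apply/eqP/setP=> b; rewrite !inE; apply/eqP=> cE.
  by rewrite -cE imset_f in cn.
rewrite -sum_nat_const.
apply: (@leq_trans (\sum_w \sum_c (deg c w - 1))).
  rewrite [leqRHS](bigID (mem many_missing)) /=; apply: leq_trans (leq_addr _ _).
  apply: leq_sum => w; rewrite inE; have := excess w.
  by move: (\sum_c _) => s; lia.
rewrite exchange_big /=; apply: (@leq_trans (\sum_(c < k) 6 * k.+1)).
  by apply: leq_sum => c _; exact: page.
by rewrite sum_nat_const card_ord; lia.
Qed.

Lemma card_whites_bound (z : nat) :
  exists A r t, [/\ A <= k + 2, r * z <= k.+1, t <= k.+1 &
    #|W| <= #|many_missing| + 2 * A + z * (3 * k + 2 + 4 * D * A + A)
      + 2 * (3 * k + 2 + 3 * D * A) + t * (k.+1 - t + r.+1 * (2 * D + 3))].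
Proof.
have [pB_inj pW_inj pBW ncr] := nc.
pose V := {w in ~: many_missing}.
pose col' b (w : V) := col b (val w); pose pV (w : V) := pW (val w).
have pV_inj : injective pV by move=> v v' /pW_inj/val_inj.
have nc' : noncrossing_star col' pB pV.
  by split=> // [b w|a w b w' ww']; [exact: pBW|apply: ncr; rewrite (inj_eq val_inj)].
have few w : k <= #|colours col' w setT| + D.
  by have := valP w; rewrite !inE -leqNgt.
have [A [g [h [f [l [gs AB]]]]]] := exists_gap_structure pV_inj (fun b w => pBW b (val w)).
exists A, #|big_groups h z|, #|big_blacks h z|; split.
- by rewrite addn2 -cardB.
- exact: card_big_groups.
- exact: card_big_blacks.
have -> : #|W| = #|many_missing| + #|{: V}| by rewrite card_sig -(cardsC many_missing).
by have := card_whites_by_gaps nc' cardB few gs z; rewrite -!addnA leq_add2l.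
Qed.

End PagesBound.

(** * Choice of the parameters *)

Lemma fourth_root_floor k : 0 < k -> exists q, [/\ 0 < q, q ^ 4 <= k & k < q.+1 ^ 4].
Proof.
move=> k0; have ex : exists q, q ^ 4 <= k by exists 0.
have ub q : q ^ 4 <= k -> q <= k.
  by apply: leq_trans; case: q => // q; rewrite -{1}[q.+1]expn1; exact: leq_pexp2l.
case: (ex_maxnP ex ub) => q qk qmax; exists q; split=> //.
  by apply: qmax; rewrite exp1n.
by rewrite ltnNge; apply/negP=> /qmax; rewrite ltnn.
Qed.

Local Open Scope ring_scope.

(* Here [q] is both the number of missing pages that is tolerated and the square
   root of the size from which a group is big. *)
Lemma pages_bound_arith (R : realFieldType) (k q A r t N : nat) (bad : nat) (u : R) :
  (0 < k)%N -> 0 <= u -> u ^+ 4 = k%:R -> (0 < q)%N -> (q ^ 4 <= k)%N -> (k < q.+1 ^ 4)%N ->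
  (A <= k + 2)%N -> (r * q ^ 2 <= k.+1)%N -> (t <= k.+1)%N -> (bad * (q + 2) <= 6 * k * k.+1)%N ->
  (N <= bad + 2 * A + q ^ 2 * (3 * k + 2 + 4 * q * A + A) + 2 * (3 * k + 2 + 3 * q * A)
     + t * (k.+1 - t + r.+1 * (2 * q + 3)))%N ->
  4 * N%:R <= k%:R ^+ 2 + 2000 * u ^+ 7.
Proof.
move=> k0 u0 uk q0 qk kq Ak rk tk badk NE.
have kR : 1 <= k%:R :> R by rewrite ler1n.
have u1 : 1 <= u by rewrite -(@ler_pXn2r _ 4) ?nnegrE // uk expr1n.
have qu : q%:R <= u :> R by rewrite -(@ler_pXn2r _ 4) ?nnegrE // uk -natrX ler_nat.
have uq : u <= q%:R + 1.
  by rewrite -(@ler_pXn2r _ 4) ?nnegrE ?addr_ge0 // uk natr1 -natrX ler_nat ltnW.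
have q1 : 1 <= q%:R :> R by rewrite ler1n.
have {}Ak : A%:R <= k%:R + 2 :> R by rewrite -natrD ler_nat.
have {}rk : r%:R * q%:R ^+ 2 <= k%:R + 1 :> R by rewrite -natrX -natrM natr1 ler_nat.
have {}badk : bad%:R * (q%:R + 2) <= 6 * k%:R * (k%:R + 1) :> R.
  by rewrite natr1 -natrD -!natrM ler_nat.
pose s := (k.+1 - t)%N; have st : (s + t = k.+1)%N by rewrite subnK.
have {}st : s%:R + t%:R = k%:R + 1 :> R by rewrite -natrD st natr1.
have {}NE : N%:R <= bad%:R + 2 * A%:R + q%:R ^+ 2 * (3 * k%:R + 2 + 4 * q%:R * A%:R + A%:R)
    + 2 * (3 * k%:R + 2 + 3 * q%:R * A%:R)
    + t%:R * (s%:R + (r%:R + 1) * (2 * q%:R + 3)) :> R.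
  by rewrite natr1 -!(natrX, natrM, natrD) ler_nat.
move: NE badk st rk Ak q1 uq qu kR.
have := ler0n R bad; have := ler0n R A; have := ler0n R s; have := ler0n R t; have := ler0n R r.
rewrite -{}uk; move: (bad%:R) (A%:R) (s%:R) (t%:R) (r%:R) (q%:R) (N%:R) => b a s' t' r' q' n'.
move=> r0 t0 s0 a0 b0 NE badk st rk ak q1 uq qu k1.
have u2 i : 1 <= u ^+ i by exact: exprn_ege1.
have E i j : (i <= j)%N -> u ^+ i <= u ^+ j by move=> ij; exact: ler_weXn2l.
(* Each error term is bounded by a multiple of [u ^+ 7]; after the factor 4 the coefficients add up
   to less than 2000. *)
have bad_le : b <= 12 * u ^+ 7.
  rewrite -(ler_pM2r (_ : 0 < u)); last by lra.
  have : b * u <= b * (q' + 2) by apply: ler_wpM2l => //; lra.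
  have : 6 * u ^+ 4 * (u ^+ 4 + 1) <= 12 * u ^+ 7 * u.
    have -> : 12 * u ^+ 7 * u = 12 * (u ^+ 4 * u ^+ 4) by ring.
    by have := u2 4; nra.
  by lra.
have a_le : a <= 3 * u ^+ 4 by have := u2 4; lra.
have aq_le : q' * a <= 3 * u ^+ 5.
  have : q' * a <= u * (3 * u ^+ 4) by apply: ler_pM => //; lra.
  by rewrite mulrCA -exprS.
have c1 : q' ^+ 2 * (3 * u ^+ 4 + 2 + 4 * q' * a + a) <= 20 * u ^+ 7.
  have -> : 20 * u ^+ 7 = u ^+ 2 * (20 * u ^+ 5) by ring.
  apply: ler_pM; rewrite ?sqr_ge0 //.
  - have : 0 <= q' * a by apply: mulr_ge0 => //; lra.
    by have := u2 4; lra.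
  - by rewrite ler_pXn2r ?nnegrE //; lra.
  by have := E 4 5 isT; have := u2 5; lra.
have c2 : 2 * (3 * u ^+ 4 + 2 + 3 * q' * a) <= 28 * u ^+ 7.
  by have := E 4 7 isT; have := E 5 7 isT; have := u2 7; lra.
have rq_le : r' * q' <= 4 * u ^+ 3.
  rewrite -(ler_pM2r (_ : 0 < u)); last by lra.
  have : r' * q' * u <= r' * q' * (2 * q').
    by apply: ler_wpM2l; [apply: mulr_ge0; lra|lra].
  have -> : r' * q' * (2 * q') = 2 * (r' * q' ^+ 2) by ring.
  have -> : 4 * u ^+ 3 * u = 4 * u ^+ 4 by ring.
  by have := u2 4; lra.
have r_le : r' <= r' * q' by rewrite ler_peMr.
have c3 : t' * ((r' + 1) * (2 * q' + 3)) <= 50 * u ^+ 7.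
  have -> : 50 * u ^+ 7 = (2 * u ^+ 4) * (25 * u ^+ 3) by ring.
  apply: ler_pM => //.
  - by apply: mulr_ge0; lra.
  - by have := u2 4; lra.
  have -> : (r' + 1) * (2 * q' + 3) = 2 * (r' * q') + 3 * r' + 2 * q' + 3 by ring.
  by have := E 1%N 3 isT; have := u2 3; rewrite expr1; lra.
(* The arithmetic-geometric mean inequality gives the main term [u ^+ 8], which is [k ^ 2]. *)
have c4 : 4 * (t' * s') <= u ^+ 8 + 3 * u ^+ 7.
  have : 4 * (t' * s') <= (s' + t') ^+ 2 by rewrite -subr_ge0 (_ : _ - _ = (s' - t') ^+ 2) ?sqr_ge0 //; ring.
  have -> : (s' + t') ^+ 2 = u ^+ 8 + 2 * u ^+ 4 + 1 by rewrite st; ring.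
  by have := E 4 7 isT; have := u2 7; lra.
have -> : (u ^+ 4) ^+ 2 = u ^+ 8 by ring.
have := E 4 7 isT; have := u2 7.
rewrite mulrDr in NE; lra.
Qed.

Theorem book_embedding_bound (R : realFieldType) (B W : finType) (k : nat)
    (col : B -> W -> 'I_k) (pB : B -> nat) (pW : W -> nat) (u : R) :
  noncrossing_star col pB pW -> #|B| = k.+1 -> 0 <= u -> u ^+ 4 = k%:R ->
  4 * #|W|%:R <= k%:R ^+ 2 + 2000 * u ^+ 7.
Proof.
move=> nc cardB u0 uk.
have [k0|k0] := posnP k.
  (* A white vertex would have an edge, since [B] is nonempty, but no page to draw it in. *)
  have -> : #|W| = 0%N.
    apply: eq_card0 => w; have /card_gt0P[b _] : (0 < #|B|)%N by rewrite cardB.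
    by case: (col b w) => i; rewrite k0.
  by rewrite mulr0 addr_ge0 ?sqr_ge0 ?mulr_ge0 ?exprn_ge0.
have [q [q0 qk kq]] := fourth_root_floor k0.
have [A [r [t [Ak rk tk NE]]]] := card_whites_bound q nc cardB (q ^ 2)%N.
have := card_many_missing q nc cardB.
move=> badk; exact: (pages_bound_arith k0 u0 uk q0 qk kq Ak rk tk badk NE).
Qed.

Local Close Scope ring_scope.

(** * Drawings, averaging and the lower bound *)

Section StarDrawings.
Variables (B W : finType) (k : nat).

Definition placement (pB : B -> nat) (pW : W -> nat) : Prop :=
  [/\ injective pB, injective pW & forall b w, pB b != pW w].

Definition star_cross (col : B -> W -> 'I_k) (pB : B -> nat) (pW : W -> nat) :
    {set (B * W) * (B * W)} :=
  [set ef | (col ef.1.1 ef.1.2 == col ef.2.1 ef.2.2) &&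
            cross4 (pB ef.1.1) (pW ef.1.2) (pB ef.2.1) (pW ef.2.2)].
End StarDrawings.

Lemma bigminn_le (I : finType) (x : nat) (F : I -> nat) i :
  \big[minn/x]_j F j <= F i.
Proof.
have := mem_index_enum i; elim: (index_enum I) => //= j s IH.
rewrite inE big_cons geq_min => /orP[/eqP->|/IH->].
  by rewrite leqnn.
by rewrite orbT.
Qed.

Lemma bigminn_attained (I : finType) (x : nat) (F : I -> nat) :
  \big[minn/x]_j F j = x \/ exists i, \big[minn/x]_j F j = F i.
Proof.
elim/big_rec: _ => [|i y _ [->|[j ->]]]; first by left.
  by case: (leqP (F i) x) => _; [right; exists i|left].
by right; case: (leqP (F i) (F j)) => _; [exists i|exists j].
Qed.

(** Arbitrary positions give a spine order through their ranks, and [cross4] depends only on the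
    order. *)
Lemma nu_K_le (k m n : nat) (col : 'I_m -> 'I_n -> 'I_k) pB pW :
  placement pB pW -> nu_K k m n <= #|star_cross col pB pW|.
Proof.
case=> pB_inj pW_inj pBW.
pose pos (v : 'I_m + 'I_n) := match v with inl b => pB b | inr w => pW w end.
have pos_inj : injective pos.
  move=> [b|w] [b'|w'] /= => [/pB_inj-> | /eqP | /esym/eqP | /pW_inj->] //;
  by rewrite (negPf (pBW _ _)).
pose s0 v := enum_val (Ordinal (rank_bound pos v)).
have s0_rank v : enum_rank (s0 v) = rank pos v :> nat by rewrite enum_valK.
have s0_inj : injective s0.
  by move=> u v uv; apply: (rank_inj pos_inj); rewrite -!s0_rank uv.
pose d : book_drawing ('I_m + 'I_n)%type ('I_m * 'I_n)%type k :=
  (perm s0_inj, [ffun e => col e.1 e.2]).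
apply: leq_trans (bigminn_le _ _ d) _; apply: subset_leq_card.
apply/subsetP=> -[e f]; rewrite !inE /book_cross !ffunE /= => /andP[->] /=.
have sE v : spine_pos (perm s0_inj) v = rank pos v by rewrite /spine_pos permE s0_rank.
rewrite /lo_end /hi_end !sE -/(cross4 _ _ _ _) /=.
by rewrite -/(cross4 (rank pos (inl e.1)) (rank pos (inr e.2))
  (rank pos (inl f.1)) (rank pos (inr f.2))) (cross4_rank pos_inj).
Qed.

Lemma nu_K_attained (k m n : nat) : 0 < k ->
  exists (col : 'I_m -> 'I_n -> 'I_k) pB pW,
    placement pB pW /\ #|star_cross col pB pW| = nu_K k m n.
Proof.
move=> k0.
have [d dE] : exists d : book_drawing ('I_m + 'I_n)%type ('I_m * 'I_n)%type k,
    nu_K k m n = book_crossings (@Kmn_ends m n) d.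
  (* If the minimum equals its seed, any drawing attains it, because none has more crossings than
     the seed. *)
  pose d0 : book_drawing ('I_m + 'I_n)%type ('I_m * 'I_n)%type k := (1%g, [ffun => Ordinal k0]).
  have [nuE|[d dE]] := @bigminn_attained _ (#|{: 'I_m * 'I_n}| ^ 2)
    (fun d : book_drawing _ _ k => book_crossings (@Kmn_ends m n) d); last by exists d.
  exists d0; apply/eqP; rewrite eqn_leq bigminn_le /=.
  rewrite [leqRHS]nuE -mulnn -card_prod; exact: max_card.
exists (fun b w => d.2 (b, w)), (fun b => spine_pos d.1 (inl b)), (fun w => spine_pos d.1 (inr w)).
have pos_inj : injective (spine_pos d.1).
  by move=> u v /val_inj/enum_rank_inj/perm_inj.
split; first split.
- by move=> b b' /pos_inj[].
- by move=> b b' /pos_inj[].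
- by move=> b w; apply/eqP=> /pos_inj.
rewrite dE; congr #|pred_of_set _|; apply/setP=> -[[a w] [b w']]; by rewrite !inE.
Qed.

(** * Turan's theorem *)

Section Turan.
Variables (T : finType) (adj : rel T) (S : nat).
Hypotheses (adj_sym : symmetric adj) (adj_irr : irreflexive adj).

Definition independent (I : {set T}) : bool := [forall x in I, forall y in I, ~~ adj x y].

Hypothesis small_independent : forall I : {set T}, independent I -> #|I| <= S.

(* Remove a maximal independent set: every other vertex has a neighbour in it. *)
Lemma turan_in (X : {set T}) :
  #|X| ^ 2 <= S * (#|[set p in setX X X | adj p.1 p.2]| + #|X|).
Proof.
move: {2}#|X| (leqnn #|X|) => n; elim: n X => [|n IH] X Xn.
  by move: Xn; rewrite leqn0 => /eqP->.
case: (set_0Vmem X) => [->|[x0 x0X]]; first by rewrite cards0.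
pose P (I : {set T}) := (I \subset X) && independent I.
have P1 : P [set x0].
  rewrite /P sub1set x0X; apply/forall_inP=> x /set1P->; apply/forall_inP=> y /set1P->.
  by rewrite adj_irr.
have [I /maxsetP[/andP[IX indI] Imax] x0I] := maxset_exists P1.
have I0 : 0 < #|I| by apply/card_gt0P; exists x0; rewrite -sub1set.
pose Y := X :\: I; have cX : #|Y| + #|I| = #|X|.
  by rewrite /Y cardsDS // subnK ?subset_leq_card.
have Yn : #|Y| <= n by lia.
have nb y : exists i, y \in Y -> (i \in I) && adj i y.
  have [yY|] := boolP (y \in Y); last by exists x0.
  have [/exists_inP[i iI iy]|no] := boolP [exists i in I, adj i y]; first by exists i; rewrite iI.
  have : y |: I = I.
    apply: Imax; last by apply/subsetP=> i iI; rewrite !inE iI orbT.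
    move: yY; rewrite inE => /andP[yI yX]; rewrite /P subUset sub1set yX IX /=.
    have noy i : i \in I -> ~~ adj i y.
      by move=> iI; apply: contra no => iy; apply/exists_inP; exists i.
    apply/forall_inP=> a /setU1P aP; apply/forall_inP=> b /setU1P bP.
    case: aP bP => [->|aI] [->|bI]; rewrite ?adj_irr //; first by rewrite adj_sym noy.
      exact: noy.
    by have /forall_inP/(_ a aI)/forall_inP/(_ b bI) := indI.
  by move=> yI; have := setU11 y I; rewrite yI => yinI; move: yY; rewrite inE yinI.
have [i iP] := fin_all_exists nb.
pose E (Z : {set T}) := [set p in setX Z Z | adj p.1 p.2].
(* Each [y] contributes two ordered pairs with its chosen neighbour [i y] in [I], so [E X] exceeds
   [E Y] by at least [2 * #|Y|]. *)
have big : E Y :|: [set (y, i y) | y in Y] :|: [set (i y, y) | y in Y] \subset E X.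
  have YX y : y \in Y -> y \in X by rewrite inE => /andP[].
  have IX' y : y \in I -> y \in X by apply/subsetP.
  apply/subsetP=> p; rewrite !in_setU => /orP[/orP[]|].
  - by rewrite !inE => /andP[/andP[/andP[_ ->] /andP[_ ->]] ->].
  - by case/imsetP=> y yY ->; have /andP[iI a] := iP y yY; rewrite inE in_setX /= (YX _ yY) (IX' _ iI) adj_sym.
  - by case/imsetP=> y yY ->; have /andP[iI a] := iP y yY; rewrite inE in_setX /= (YX _ yY) (IX' _ iI).
have YI y : y \in Y -> y \in I -> False by rewrite inE => /andP[/negP].
have := subset_leq_card big.
rewrite cardsU disjoint_setI0 ?cards0 ?subn0; last first.
  apply/pred0P=> p /=; apply/negP=> /andP[+ /imsetP[y yY pE]]; have /andP[iI _] := iP y yY.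
  rewrite pE in_setU => /orP[|/imsetP[y' y'Y [e _]]].
    by rewrite !inE /= iI.
  by apply: (YI _ y'Y); rewrite -e.
rewrite cardsU disjoint_setI0 ?cards0 ?subn0; last first.
  apply/pred0P=> p /=; apply/negP=> /andP[+ /imsetP[y yY pE]]; have /andP[iI _] := iP y yY.
  by rewrite pE !inE /= iI /= andbF.
rewrite !card_imset; [|by move=> y y' []|by move=> y y' []].
have := IH Y Yn; rewrite -/(E Y) -/(E X) -cX; have := small_independent indI.
move: #|E Y| #|E X| #|Y| #|I| => a b c d; nia.
Qed.

Lemma turan : #|T| ^ 2 <= S * (#|[set p : T * T | adj p.1 p.2]| + #|T|).
Proof.
have := turan_in setT; rewrite cardsT.
by rewrite (_ : [set p in _ | _] = [set p | adj p.1 p.2]) //; apply/setP=> p; rewrite !inE.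
Qed.
End Turan.

(** * Subdrawings and averaging *)

Section Averaging.
Variables (B : finType) (k : nat).

Lemma star_cross_neq (W : finType) (col : B -> W -> 'I_k) pB pW ef :
  ef \in star_cross col pB pW -> ef.1.2 != ef.2.2.
Proof.
rewrite inE => /andP[_]; apply: contraTneq => ->; rewrite /cross4; lia.
Qed.

Lemma card_star_cross_comp (V W : finType) (phi : V -> W) (col : B -> W -> 'I_k) pB pW :
  injective phi ->
  #|star_cross (fun b v => col b (phi v)) pB (pW \o phi)|
    <= #|[set ef in star_cross col pB pW | (ef.1.2 \in codom phi) && (ef.2.2 \in codom phi)]|.
Proof.
move=> phi_inj; pose lift (ef : (B * V) * (B * V)) := ((ef.1.1, phi ef.1.2), (ef.2.1, phi ef.2.2)).
have lift_inj : injective lift.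
  by move=> [[a v] [b w]] [[a' v'] [b' w']] [-> /phi_inj-> -> /phi_inj->].
rewrite -(card_imset _ lift_inj); apply: subset_leq_card; apply/subsetP=> _ /imsetP[ef efP ->].
by move: efP; rewrite !inE /= => ->; rewrite !codom_f.
Qed.
End Averaging.

Lemma placement_comp (B V W : finType) (phi : V -> W) (pB : B -> nat) (pW : W -> nat) :
  injective phi -> placement pB pW -> placement pB (pW \o phi).
Proof. by move=> phi_inj [pBi pWi pBW]; split=> // [|b w]; [exact: inj_comp|exact: pBW]. Qed.

(* Delete each white vertex in turn: a crossing involves exactly two of them. *)
Lemma nu_K_averaging k m n : 0 < k -> n.+1 * nu_K k m n <= n.-1 * nu_K k m n.+1.
Proof.
move=> k0; have [col [pB [pW [pl crE]]]] := nu_K_attained m n.+1 k0.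
have le j : nu_K k m n <= #|[set ef in star_cross col pB pW | (ef.1.2 != j) && (ef.2.2 != j)]|.
  have := nu_K_le (fun b v => col b (lift j v)) (placement_comp (@lift_inj _ j) pl).
  move/leq_trans; apply; apply: leq_trans (card_star_cross_comp _ _ _ (@lift_inj _ j)) _.
  apply: subset_leq_card; apply/subsetP=> ef; rewrite !in_set => /andP[-> /andP[]].
  by case/codomP=> i -> /codomP[i' ->]; rewrite -!(eq_sym j) !neq_lift.
have : \sum_(j < n.+1) nu_K k m n <= \sum_(j < n.+1)
    #|[set ef in star_cross col pB pW | (ef.1.2 != j) && (ef.2.2 != j)]|.
  by apply: leq_sum => j _; exact: le.
rewrite sum_nat_const card_ord => /leq_trans; apply.
rewrite -crE mulnC -sum_nat_const.
have -> : \sum_(j < n.+1) #|[set ef in star_cross col pB pW | (ef.1.2 != j) && (ef.2.2 != j)]|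
    = \sum_(j < n.+1) \sum_(ef in star_cross col pB pW) ((ef.1.2 != j) && (ef.2.2 != j)).
  apply: eq_bigr => j _; rewrite -sum1_card big_mkcond [RHS]big_mkcond; apply: eq_bigr => ef _.
  by rewrite in_set; case: (ef \in _) => //=; case: (_ && _).
rewrite exchange_big /=; apply: leq_sum => ef efP.
have : #|[set ef.1.2; ef.2.2]| + #|~: [set ef.1.2; ef.2.2]| = n.+1 by rewrite cardsC card_ord.
rewrite cards2 (star_cross_neq efP) => cE.
apply: (@leq_trans #|~: [set ef.1.2; ef.2.2]|); last by lia.
rewrite -sum1_card [leqRHS]big_mkcond; apply: leq_sum => j _; rewrite !inE negb_or.
by rewrite ![j == _]eq_sym; case: (_ && _).
Qed.

Local Open Scope ring_scope.

Lemma nu_K_lower (R : realFieldType) (k n : nat) (u : R) :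
  (0 < k)%N -> (0 < n)%N -> 0 <= u -> u ^+ 4 = k%:R ->
  2 * n%:R ^+ 2 / (k%:R ^+ 2 + 2000 * u ^+ 7) - n%:R < (nu_K k k.+1 n)%:R.
Proof.
move=> k0 n0 u0 uk; have [col [pB [pW [pl <-]]]] := nu_K_attained k.+1 n k0.
set C := star_cross col pB pW.
pose d (w w' : 'I_n) := [exists a, exists b, ((a, w), (b, w')) \in C].
pose adj w w' := d w w' || d w' w.
have adj_irr : irreflexive adj.
  move=> w; rewrite /adj orbb; apply/existsP=> -[a /existsP[b /star_cross_neq]].
  by rewrite eqxx.
have adj_sym : symmetric adj by move=> w w'; rewrite /adj orbC.
pose S := \max_(I : {set 'I_n} | independent adj I) #|I|.
have S_ub (I : {set _}) : independent adj I -> (#|I| <= S)%N.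
  exact: (@leq_bigmax_cond _ (independent adj) (fun I : {set 'I_n} => #|I|) I).
have := turan adj_sym adj_irr S_ub.
have : 4 * S%:R <= k%:R ^+ 2 + 2000 * u ^+ 7.
  have i0 : independent adj set0 by apply/forall_inP=> x; rewrite inE.
  have ex : (0 < #|[pred I | independent adj I]|)%N by apply/card_gt0P; exists set0.
  have [I iI SI] := eq_bigmax_cond (fun I : {set 'I_n} => #|I|) ex.
  have -> : S = #|I| by exact: SI.
  (* The stars of an independent set form a crossing-free drawing, so the book embedding bound
     applies to it. *)
  have <- : #|{: {w in I}}| = #|I| by rewrite card_sig; apply: eq_card.
  apply: (@book_embedding_bound R 'I_k.+1 {w in I} k (fun b w => col b (val w)) pB (fun w => pW (val w)));
    rewrite ?card_ord //.
  have [pBi pWi pBW] := pl; split=> // [w w' /pWi/val_inj //|a w b w' ww' cE].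
  apply/negP=> cr; have /forall_inP/(_ _ (valP w))/forall_inP/(_ _ (valP w')) := iI.
  case/negP; apply/orP; left; apply/existsP; exists a; apply/existsP; exists b.
  by rewrite inE /= cE eqxx.
have dC : (#|[set p | d p.1 p.2]| <= #|C|)%N.
  pose pr (ef : ('I_k.+1 * 'I_n) * ('I_k.+1 * 'I_n)) := (ef.1.2, ef.2.2).
  apply: leq_trans (leq_imset_card pr C); apply: subset_leq_card.
  apply/subsetP=> -[w w']; rewrite inE /= => /existsP[a /existsP[b abC]].
  by apply/imsetP; exists ((a, w), (b, w')).
have eC : (#|[set p | adj p.1 p.2]| <= 2 * #|C|)%N.
  have -> : [set p | adj p.1 p.2] = [set p | d p.1 p.2] :|: [set (p.2, p.1) | p in [set p | d p.1 p.2]].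
    apply/setP=> -[w w']; rewrite !inE /adj /=; congr orb; apply/idP/imsetP=> [dw|[[v v']]].
      by exists (w', w); rewrite ?inE.
    by rewrite inE /= => dv [-> ->].
  apply: leq_trans (leq_card_setU _ _).1 _; rewrite mul2n -addnn leq_add //.
  by apply: leq_trans (leq_imset_card _ _) dC.
rewrite card_ord => SR /leq_trans/(_ (leq_mul (leqnn S) (leq_add eC (leqnn n)))).
rewrite -(ler_nat R) natrX natrM natrD natrM => tur.
have K0 : 0 < k%:R ^+ 2 + 2000 * u ^+ 7.
  by rewrite ltr_pwDl ?mulr_ge0 ?exprn_ge0 // exprn_gt0 // ltr0n.
have nR : 0 < n%:R :> R by rewrite ltr0n.
rewrite ltrBlDr ltr_pdivrMr //; move: tur SR; rewrite -/C.
have : 0 <= #|C|%:R :> R by rewrite ler0n.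
move: (k%:R ^+ 2 + 2000 * u ^+ 7) K0 (S%:R) (#|C|%:R) => K K0 s c c0 tur SR.
have : 4 * (s * (2 * c + n%:R)) <= K * (2 * c + n%:R).
  by rewrite mulrA ler_wpM2r // addr_ge0 ?mulr_ge0 // ltW.
(* [4 n^2 <= K (2 c + n)] gives the bound with [n / 2] subtracted; the other half of [n] makes it
   strict. *)
by have := mulr_gt0 K0 nR; lra.
Qed.

Local Close Scope ring_scope.

(** * The upper bound *)

Section Construction.
Variables (A p n k : nat).
Hypotheses (A0 : 0 < A) (p0 : 0 < p) (kE : A + p = k.+1).

Let s := A * p.
Let gap (a : nat) : nat := (a %% s) %/ p.
Let slot (a : nat) : nat := (a %% s) %% p.

Let s0 : 0 < s. Proof. by rewrite muln_gt0 A0. Qed.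
Let gapA a : gap a < A. Proof. by rewrite ltn_divLR // ltn_pmod. Qed.
Let slotp a : slot a < p. Proof. by rewrite ltn_pmod. Qed.

(* The [A] gaps are separated by the black vertices [0, ..., A-2] and followed by
   the group [A-1, ..., A+p-1].  The white vertex [a] is a clone of the vertex in
   slot [slot a] of [gap a]; it repeats a page exactly at the black vertices
   [A-1 + slot a] and [A + slot a]. *)
Definition page_nat (u a : nat) : nat :=
  if u < A.-1 then (if gap a <= u then u + p else u)
  else gap a + (u - A.-1) - (slot a < u - A.-1).

Lemma page_nat_bound u a : u < k.+1 -> page_nat u a < k.
Proof.
move=> uk; rewrite /page_nat; have := gapA a; have := slotp a.
by case: (ltnP u) => ?; [case: (leqP (gap a) u) => ?|]; lia.
Qed.

(* Encodes the lexicographic order on triples with [y <= p] and [z <= n]. *)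
Definition lex (x y z : nat) : nat := (x * p.+1 + y) * n.+1 + z.

Lemma ltn_pair N x z x' z' : z < N -> z' < N ->
  (x * N + z < x' * N + z') = (x < x') || ((x == x') && (z < z')).
Proof.
move=> zN z'N; case: (ltngtP x x') => [lt|gt|->] /=; last by rewrite ltn_add2l.
  by have := leq_mul lt (leqnn N); rewrite mulSn; lia.
by have := leq_mul gt (leqnn N); rewrite mulSn; lia.
Qed.

Lemma ltn_lex x y z x' y' z' : y <= p -> y' <= p -> z <= n -> z' <= n ->
  (lex x y z < lex x' y' z') =
  (x < x') || ((x == x') && ((y < y') || ((y == y') && (z < z')))).
Proof.
move=> yp y'p zn z'n; rewrite /lex ltn_pair // ltn_pair //.
have -> : (x * p.+1 + y == x' * p.+1 + y') = (x == x') && (y == y').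
  rewrite eqn_leq !(leqNgt (_ * _ + _)) !ltn_pair //; lia.
lia.
Qed.

Definition black_pos (u : nat) : nat :=
  if u < A.-1 then lex u p 0 else lex A (u - A.-1) 0.
Definition white_pos (a : nat) : nat := lex (gap a) (slot a) a.

(** An edge to a separator [u] has page [u + p] from the left and [u] from the right, while the
    white vertices it encloses reach the final group in smaller, respectively larger, pages. For two
    crossing edges to the final group, black and white ends come in the same order; equal pages then
    force the same gap, consecutive black vertices and the same slot. *)
Lemma page_cross u v a b : u < k.+1 -> v < k.+1 -> a < n -> b < n ->
  page_nat u a = page_nat v b ->
  cross4 (black_pos u) (white_pos a) (black_pos v) (white_pos b) ->
  [/\ a < b, gap a = gap b, slot a = slot b & (u = A.-1 + slot a) /\ v = u.+1].
Proof.
move=> uk vk an bn; have := gapA a; have := gapA b; have := slotp a; have := slotp b.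
rewrite /cross4 !(gtn_min, gtn_max, leq_min, leq_max) /black_pos /white_pos /page_nat.
move: (gap a) (gap b) (slot a) (slot b) => i i' j j' j'p jp i'A iA.
case: (ltnP u A.-1) => uA; case: (ltnP v A.-1) => vA.
- rewrite !ltn_lex //; try lia.
  case: (leqP i u) => iu; case: (leqP i' v) => iv; lia.
- rewrite !ltn_lex //; try lia.
  case: (leqP i u) => iu; lia.
- rewrite !ltn_lex //; lia.
rewrite !ltn_lex //; try lia.
set x := u - A.-1; set y := v - A.-1; have uE : u = A.-1 + x by lia.
have vE : v = A.-1 + y by lia.
move=> eqp crs; have xy : x < y by clear eqp; lia.
have : (i < i') || ((i == i') && ((j < j') || ((j == j') && (a < b)))) by clear eqp; lia.
move: eqp {crs}; rewrite {}uE {}vE.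
by case: (ltnP j x) => jx; case: (ltnP j' y) => j'y eqp lt; split; lia.
Qed.

Lemma eq_lex x y z x' y' z' : y <= p -> y' <= p -> z <= n -> z' <= n ->
  lex x y z = lex x' y' z' -> [/\ x = x', y = y' & z = z'].
Proof.
move=> yp y'p zn z'n e; have := ltnn (lex x y z); have := ltnn (lex x' y' z').
by rewrite -{1}e {2}e !ltn_lex // => lt gt; split; lia.
Qed.

Lemma book_placement : placement (fun u : 'I_k.+1 => black_pos u) (fun a : 'I_n => white_pos a).
Proof.
split.
- move=> u v; have := ltn_ord u; have := ltn_ord v; rewrite /black_pos => vk uk e.
  apply: val_inj => /=; move: e.
  by case: (ltnP u A.-1) => uA; case: (ltnP v A.-1) => vA /eq_lex[]; lia.
- move=> a b /eq_lex e; apply: val_inj; have := slotp a; have := slotp b.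
  have := ltn_ord a; have := ltn_ord b => an bn ap bp.
  by case: e => //; rewrite ltnW.
move=> u a; apply/eqP; rewrite /black_pos /white_pos.
have := ltn_ord u; have := ltn_ord a; have := gapA a; have := slotp a => ap ga an uk.
by case: (ltnP u A.-1) => uA /eq_lex[]; lia.
Qed.

(** By [page_cross] a crossing is determined by two clones [a < b] congruent modulo [s], and each
    [b] has at most [b %/ s] such [a]. *)
Lemma nu_K_upper_nat : nu_K k k.+1 n * (2 * (A * p)) <= n ^ 2.
Proof.
pose col (u : 'I_k.+1) (a : 'I_n) : 'I_k := Ordinal (page_nat_bound a (ltn_ord u)).
have := nu_K_le col book_placement; set C := star_cross _ _ _ => nuC.
have CP ef : ef \in C -> [/\ ef.1.2 < ef.2.2, ef.1.2 = ef.2.2 %[mod s] &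
    ef.1.1 = A.-1 + slot ef.1.2 :> nat /\ ef.2.1 = ef.1.1.+1 :> nat].
  case: ef => [[u a] [v b]]; rewrite inE => /andP[/= /eqP[e]].
  move=> /(page_cross (ltn_ord u) (ltn_ord v) (ltn_ord a) (ltn_ord b) e)[ab gE sE uv].
  by split=> //; rewrite (divn_eq (a %% s) p) (divn_eq (b %% s) p) -/(gap a) -/(slot a) gE sE.
pose pr (ef : ('I_k.+1 * 'I_n) * ('I_k.+1 * 'I_n)) := (ef.1.2, ef.2.2).
have pr_inj : {in C &, injective pr}.
  move=> [[u a] [v b]] [[u' a'] [v' b']] /CP[_ _ /= [uE vE]] /CP[_ _ /= [u'E v'E]] [/= aE bE].
  have uu : u = u' by apply: val_inj; rewrite /= uE u'E aE.
  by rewrite aE bE uu; congr ((_, _), (_, _)); apply: val_inj; rewrite /= vE v'E uu.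
have cC : #|C| <= \sum_(b < n) b %/ s.
  rewrite -(card_in_imset pr_inj).
  apply: (@leq_trans (\sum_(b < n) #|[set a : 'I_n | (a < b) && (a == b %[mod s])]|)).
    rewrite (eq_bigr (fun b : 'I_n => \sum_(a < n) ((a < b) && (a == b %[mod s]) : nat))); last first.
      move=> b _; rewrite -sum1_card big_mkcond; apply: eq_bigr => a _; rewrite inE.
      by case: (_ && _).
    rewrite exchange_big pair_big /= -sum1_card big_mkcond; apply: leq_sum => -[a b] _ /=.
    by case: imsetP => [[ef /CP[lt md _] [-> ->]]|] //; rewrite lt md eqxx.
  apply: leq_sum => b _; rewrite -[leqRHS]card_ord.
  have bs (a : 'I_n) : (a < b) && (a == b %[mod s]) -> a %/ s < b %/ s.
    case/andP=> ab /eqP md; move: ab; rewrite {1}(divn_eq a s) {1}(divn_eq b s) md ltn_add2r.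
    by rewrite ltn_mul2r => /andP[].
  have [b0|b0] := posnP (b %/ s).
    rewrite card_ord b0 leqn0 cards_eq0; apply/eqP/setP=> a; rewrite !inE; apply/negP=> /bs.
    by rewrite b0.
  pose q (a : 'I_n) : 'I_(b %/ s) := insubd (Ordinal b0) (a %/ s).
  have q_inj : {in [set a : 'I_n | (a < b) && (a == b %[mod s])] &, injective q}.
    move=> a a'; rewrite !inE => ha ha' /(congr1 val); rewrite !val_insubd !bs // => e.
    apply: val_inj; rewrite /= (divn_eq a s) (divn_eq a' s) e.
    by have /andP[_ /eqP->] := ha; have /andP[_ /eqP->] := ha'.
  by rewrite -(card_in_imset q_inj) max_card.
have tri N : 2 * \sum_(b < N) b <= N ^ 2.
  elim: N => [|N IH]; first by rewrite big_ord0.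
  rewrite big_ord_recr mulnDr /= -(addn1 N) sqrnD; move: (2 * \sum_(b < N) b) IH => t; lia.
apply: leq_trans (tri n); rewrite mulnCA leq_mul2l /=.
apply: leq_trans (leq_mul (leq_trans nuC cC) (leqnn _)) _.
by rewrite big_distrl; apply: leq_sum => b _ /=; exact: leq_trunc_div.
Qed.
End Construction.

Local Open Scope ring_scope.

(** For [p] and [A] the two halves of [k + 1], [4 A p >= (k + 1)^2 - 1 >= k^2]. *)
Lemma nu_K_upper (R : realFieldType) (k n : nat) : (0 < k)%N ->
  (nu_K k k.+1 n)%:R <= 2 * n%:R ^+ 2 / k%:R ^+ 2 :> R.
Proof.
move=> k0; pose p := (k.+1)./2; pose A := (k.+1 - p)%N.
have p0 : (0 < p)%N by rewrite /p; lia.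
have kE : (A + p = k.+1)%N by rewrite subnK // /p; lia.
have A0 : (0 < A)%N by lia.
have kAp : (k ^ 2 <= 4 * (A * p))%N by rewrite /A /p in kE *; nia.
have := nu_K_upper_nat n A0 p0 kE.
have kR : 0 < k%:R :> R by rewrite ltr0n.
rewrite ler_pdivlMr ?exprn_gt0 // -!natrX -!natrM ler_nat => H.
nia.
Qed.

(** * The limit *)

From mathcomp Require Import all_classical all_reals all_analysis.
Import Order.TTheory GRing.Theory Num.Theory.
Import numFieldNormedType.Exports.
Local Open Scope classical_set_scope.
Local Open Scope ring_scope.

Lemma nu_K_ratio_cvg (R : realType) (k : nat) : (0 < k)%N ->
  cvgn (fun n : nat => (nu_K k k.+1 n)%:R / (2 * n%:R ^+ 2 / k%:R ^+ 2) : R).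
Proof.
move=> k0; have kR : 0 < k%:R :> R by rewrite ltr0n.
(* The shift by 2 keeps [n (n - 1)] positive. *)
pose a (n : nat) : R := (nu_K k k.+1 n.+2)%:R / (n.+2%:R * n.+1%:R).
have a_cvg : cvgn a.
  apply: nondecreasing_is_cvgn.
    apply/nondecreasing_seqP => n; rewrite /a.
    rewrite ler_pdivrMr ?mulr_gt0 ?ltr0n // mulrAC ler_pdivlMr ?mulr_gt0 ?ltr0n //.
    have := nu_K_averaging k.+1 n.+2 k0; rewrite -(ler_nat R) !natrM /= => av.
    have n2 : 0 <= n.+2%:R :> R by [].
    by have := ler_wpM2l n2 av; lra.
  exists (4 / k%:R ^+ 2) => _ [n _ <-]; rewrite /a ler_pdivrMr ?mulr_gt0 ?ltr0n //.
  apply: le_trans (nu_K_upper R n.+2 k0) _.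
  have -> : 4 / k%:R ^+ 2 * (n.+2%:R * n.+1%:R) = 4 * (n.+2%:R * n.+1%:R) / k%:R ^+ 2 :> R.
    by rewrite mulrAC.
  rewrite ler_wpM2r ?invr_ge0 ?sqr_ge0 // -[n.+2%:R]natr1.
  have : 1 <= n.+1%:R :> R by rewrite ler1n.
  by move: (n.+1%:R : R) => x x1; nra.
(* The factor [(n - 1) / n] turns the denominator [n (n - 1)] into [n^2]. *)
have b_cvg : (fun n => 1 - n.+2%:R^-1 : R) @ \oo --> (1 - 0 : R).
  apply: cvgB; first exact: cvg_cst.
  have := @cvg_harmonic R; rewrite -cvg_shiftS; exact.
have : (fun n => a n * ((1 - n.+2%:R^-1) * (k%:R ^+ 2 / 2))) @ \oo -->
    limn a * ((1 - 0) * (k%:R ^+ 2 / 2)).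
  by apply: cvgM => //; apply: cvgM => //; exact: cvg_cst.
rewrite (_ : (fun n => a n * _) = [sequence (nu_K k k.+1 (n + 2))%:R /
    (2 * (n + 2)%:R ^+ 2 / k%:R ^+ 2)]_n); last first.
  apply/funext => n; rewrite /a /= addn2.
  have n2 : n.+2%:R != 0 :> R by rewrite pnatr_eq0.
  have n1 : n.+1%:R != 0 :> R by rewrite pnatr_eq0.
  have k1 : k%:R != 0 :> R by rewrite gt_eqF.
  move: n2 n1; rewrite -[n.+2%:R]natr1.
  move: (n.+1%:R : R) ((nu_K k k.+1 n.+2)%:R : R) => x y x2 x1; field.
  by rewrite k1 x1 x2.
rewrite (cvg_shiftn 2 (fun n => (nu_K k k.+1 n)%:R / (2 * n%:R ^+ 2 / k%:R ^+ 2) : R)).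
by move=> lim; apply/cvg_ex; eexists; exact: lim.
Qed.

Lemma powR_seven_fourths (R : realType) (u : R) : 0 <= u -> (u ^+ 4) `^ (7 / 4) = u ^+ 7.
Proof.
move=> u0; rewrite -powR_mulrn // -powRrM (_ : 4%:R * (7 / 4) = 7%:R) ?powR_mulrn //.
by field.
Qed.

Lemma sqrt_sqrtr_exp4 (R : rcfType) (x : R) : 0 <= x -> Num.sqrt (Num.sqrt x) ^+ 4 = x.
Proof. by move=> x0; rewrite (exprM _ 2 2) !sqr_sqrtr ?sqrtr_ge0. Qed.

Theorem theorem5 (R : realType) :
  (forall k n : nat, (0 < k)%N -> (0 < n)%N ->
     2 * (n%:R) ^+ 2 * (k%:R ^+ 2 + 2000 * (k%:R `^ (7 / 4 : R)))^-1 - n%:R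
       < (nu_K k k.+1 n)%:R :> R /\
     (nu_K k k.+1 n)%:R <= 2 * (n%:R) ^+ 2 / k%:R ^+ 2 + n%:R / 2 :> R) /\
  (exists L : nat -> R,
     (forall k : nat, (0 < k)%N ->
        (fun n : nat => (nu_K k k.+1 n)%:R / (2 * (n%:R) ^+ 2 / k%:R ^+ 2) : R)
          @ \oo --> L k) /\
     L @ \oo --> (1 : R)).
Proof.
pose u (k : nat) : R := Num.sqrt (Num.sqrt k%:R).
have u0 k : 0 <= u k by exact: sqrtr_ge0.
have u4 k : u k ^+ 4 = k%:R by exact: sqrt_sqrtr_exp4.
split=> [k n k0 n0|].
  split; last by rewrite ler_wpDr ?nu_K_upper // divr_ge0.
  by rewrite -{2}u4 powR_seven_fourths //; exact: nu_K_lower.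
pose r k n : R := (nu_K k k.+1 n)%:R / (2 * n%:R ^+ 2 / k%:R ^+ 2).
exists (fun k => limn (r k)); split; first by move=> k; exact: nu_K_ratio_cvg.
(* The inner limit lies between [1 - 2000 / k^(1/4)] and 1. The inverse is put under the roots so
   that continuity of the square root at 0 applies. *)
have uinv : (fun k => 1 - 2000 * Num.sqrt (Num.sqrt k%:R^-1)) @ \oo --> (1 - 2000 * 0 : R).
  have -> : 0 = Num.sqrt (Num.sqrt 0) :> R by rewrite !sqrtr0.
  apply: cvgB; first exact: cvg_cst.
  apply: cvgM; first exact: cvg_cst.
  apply: (continuous_cvg _ (@sqrt_continuous R _)).
  apply: (continuous_cvg _ (@sqrt_continuous R _)).
  by rewrite -cvg_shiftS; exact: cvg_harmonic.
rewrite mulr0 subr0 in uinv.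
apply: (squeeze_cvgr _ uinv (cvg_cst (1 : R))).
near=> k; have k0 : (0 < k)%N by near: k; exact: nbhs_infty_gt.
have kR : 0 < k%:R :> R by rewrite ltr0n.
apply/andP; split; last first.
  apply: limr_le; first exact: nu_K_ratio_cvg.
  near=> n; have n0 : (0 < n)%N by near: n; exact: nbhs_infty_gt.
  rewrite /r ler_pdivrMr ?mul1r ?nu_K_upper // divr_gt0 ?exprn_gt0 //.
  by rewrite mulr_gt0 ?exprn_gt0 ?ltr0n.
have low : (fun n => 1 - 2000 * Num.sqrt (Num.sqrt k%:R^-1) - k%:R ^+ 2 / 2 * n%:R^-1) @ \oo -->
    (1 - 2000 * Num.sqrt (Num.sqrt k%:R^-1) - k%:R ^+ 2 / 2 * 0 : R).
  apply: cvgB; first exact: cvg_cst.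
  apply: cvgM; first exact: cvg_cst.
  by rewrite -cvg_shiftS; exact: cvg_harmonic.
rewrite mulr0 subr0 in low.
have rk : r k @ \oo --> limn (r k) by exact: nu_K_ratio_cvg.
apply: (ler_cvg_to low rk).
near=> n; have n0 : (0 < n)%N by near: n; exact: nbhs_infty_gt.
have nR : 0 < n%:R :> R by rewrite ltr0n.
have up : 0 < u k by rewrite !sqrtr_gt0.
have -> : Num.sqrt (Num.sqrt k%:R^-1) = (u k)^-1 by rewrite !sqrtrV // sqrtr_ge0.
rewrite ler_pdivlMr; last by rewrite divr_gt0 ?exprn_gt0 // mulr_gt0 ?exprn_gt0.
apply: le_trans (ltW (nu_K_lower k0 n0 (u0 k) (u4 k))).
rewrite -(u4 k); move: (u k) up (n%:R : R) nR => v v0 m m0; rewrite -subr_ge0.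
have c0 : 0 < 2000 :> R by rewrite ltr0n.
move: (2000 : R) c0 => c c0; have v2 : 0 < v + c by exact: addr_gt0.
(* This is [1 - c / v <= v / (v + c)] scaled by [2 m^2 / v^8], with the difference written out
   exactly. *)
rewrite (_ : _ - _ = 2 * c ^+ 2 * m ^+ 2 / (v ^+ 9 * (v + c))).
  by rewrite divr_ge0 ?mulr_ge0 ?sqr_ge0 ?exprn_ge0 // ltW.
by field; rewrite !gt_eqF // addr_gt0 ?mulr_gt0 ?exprn_gt0.
Unshelve. all: by end_near. Qed.
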